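(* Let $X$ and $U$ be non-trivial complex Hilbert spaces, $A_s\in\mathcal L(X)$, $B_s\in\mathcal L(U,X)$, $N\in\mathbb N$, and let $x_1=(x_1(k))_{k=1}^N$, $x_0=(x_0(k))_{k=1}^N$ be finite sequences in $X$ and $u_0=(u_0(k))_{k=1}^N$ a finite sequence in $U$ with $x_1(k)=A_sx_0(k)+B_su_0(k)$ for all $k=1,\dots,N$. Let $\gamma_-\in(0,1)$ and let $X_+,X_-$ be closed subspaces of $X$ with $X=X_+\dotplus X_-$ (direct sum, not necessarily orthogonal) and $\dim X_+<\infty$, and assume that $A_sX_-\subseteq X_-$ and that the spectral radius of $A_s|_{X_-}$ is at most $\gamma_-$. Define $\Xi_{1+},\Xi_{0+}\in\mathcal L(\mathbb C^N,X_+)$ by $$\Xi_{1+}w:=\sum_{k=1}^Nw_k\,\Pi x_1(k),\qquad \Xi_{0+}w:=\sum_{k=1}^Nw_k\,\Pi x_0(k),$$ where $\Pi$ is the projection onto $X_+$ along $X_-$. Then for every fixed $\gamma\in(\gamma_-,1)$ the following statements are equivalent: (i) The finite data $(x_1,x_0,u_0)$ are informative for stabilization on $X_+$ with some decay rate in $[\gamma_-,\gamma)$. (ii) $\operatorname{Ran}\Xi_{0+}=X_+$, and there exists a right inverse $\Xi_{0+}^\dagger\in\mathcal L(X_+,\mathbb C^N)$ of $\Xi_{0+}$ such that $\Xi_{1+}\Xi_{0+}^\dagger$ is power stable with some decay rate in $[\gamma_-,\gamma)$.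
   Context: $\mathcal L(Y,Z)$ denotes the bounded linear operators from $Y$ to $Z$, $\mathcal L(Y)=\mathcal L(Y,Y)$; $\mathbb N_0=\{0,1,2,\dots\}$; $\mathrm r(\cdot)$ is the spectral radius. For $\gamma\in(0,1)$, a bounded operator $F$ is power stable with decay rate $\gamma$ if there is $M\ge1$ with $\|F^k\|\le M\gamma^k$ for all $k\in\mathbb N_0$. Given $\gamma_-$, $X_+$, $X_-$ as in the claim, define $\mathcal A(X):=\{A\in\mathcal L(X): AX_-\subseteq X_-\ \text{and}\ \mathrm r(A|_{X_-})\le\gamma_-\}$, $\mathcal K(X,U):=\{K\in\mathcal L(X,U):K|_{X_-}=0\}$, $\Sigma_{\mathrm{is},\mathcal A}:=\{(A,B)\in\mathcal A(X)\times\mathcal L(U,X):x_1(k)=Ax_0(k)+Bu_0(k)\ \text{for all }k=1,\dots,N\}$, and for $K\in\mathcal K(X,U)$ and $\gamma\ge\gamma_-$, $\Sigma_{K,\gamma,\mathcal A}:=\{(A,B)\in\mathcal A(X)\times\mathcal L(U,X):\text{there exists }M\ge1\text{ such that }\|(A+BK)^k\|\le M\gamma^k\text{ for all }k\in\mathbb N_0\}$ (here $M$ may depend on $(A,B)$). For $\gamma\in[\gamma_-,1)$, the finite data $(x_1,x_0,u_0)$ are informative for stabilization on $X_+$ with decay rate $\gamma$ if there exists $K\in\mathcal K(X,U)$ with $\Sigma_{\mathrm{is},\mathcal A}\subseteq\Sigma_{K,\gamma,\mathcal A}$. *)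

(* Defs.v *)
From HB Require Import structures.
From mathcomp Require Import all_boot all_order all_algebra.
From mathcomp Require Import complex.
From mathcomp Require Import boolp classical_sets functions reals topology.
From mathcomp Require Import normedtype.

Set Implicit Arguments.
Unset Strict Implicit.
Unset Printing Implicit Defensive.

Import Order.TTheory GRing.Theory Num.Theory.
Import numFieldNormedType.Exports.

Local Open Scope classical_set_scope.
Local Open Scope ring_scope.

(* The inner product is linear in its first and conjugate linear in its second
   argument; norms on a normedModType over R[i] take values in R[i]. *)
HB.mixin Record NormedModule_isPreHilbert (R : realType) (X : Type)
    & NormedModule R[i] X := {
  inner : {dot X for (@Num.conj R[i])} ;
  sqr_norm_inner : forall x : X, `|x| ^+ 2 = inner x x
}.

#[short(type="hilbertType")]
HB.structure Definition Hilbert (R : realType) :=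
  {X of CompleteNormedModule R[i] X & NormedModule_isPreHilbert R X}.

(* For linear maps, continuity is boundedness (linear_bounded_continuous). *)
HB.structure Definition BoundedOperator (K : numFieldType)
    (Y Z : normedModType K) :=
  {f of @GRing.Linear K Y Z *:%R f & @isContinuous Y Z f}.

Notation "''L(' Y , Z )" := (@BoundedOperator.type _ Y Z)
  (at level 0, Y, Z at level 99, format "''L(' Y ,  Z )") : type_scope.

Record closedSubspace (K : numFieldType) (X : normedModType K) :=
  ClosedSubspace {
    csub_set :> X -> Prop ;
    csub0 : csub_set 0 ;
    csub_linear : forall (a : K) (x y : X),
      csub_set x -> csub_set y -> csub_set (a *: x + y) ;
    csub_closed : closed (csub_set : set X) }.

(* A closed subspace S of X as a normed space csubType S of its own, with the
   norm inherited from X. *)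
Section CsubType.
Context {K : numFieldType} {X : normedModType K} (S : closedSubspace X).

Definition csub_pred : {pred X} := [pred x | `[< S x >]].

Lemma csub_submod_closed : submod_closed csub_pred.
Proof.
split=> [|a x y]; first by apply/asboolP; exact: (csub0 S).
by move=> /asboolP Sx /asboolP Sy; apply/asboolP; exact: (@csub_linear _ _ S).
Qed.

HB.instance Definition _ :=
  GRing.isSubmodClosed.Build K X csub_pred csub_submod_closed.

Record csubType := CsubElt {
  csub_val : X ; csub_valP : csub_val \in csub_pred }.

HB.instance Definition _ := [isSub for csub_val].
HB.instance Definition _ := [Choice of csubType by <:].
HB.instance Definition _ := [SubChoice_isSubLmodule of csubType by <:].

Definition csub_norm (x : csubType) : K := `|\val x|.

Lemma csub_normD x y : csub_norm (x + y) <= csub_norm x + csub_norm y.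
Proof. by rewrite /csub_norm raddfD ler_normD. Qed.

Lemma csub_normZ (a : K) x : csub_norm (a *: x) = `|a| * csub_norm x.
Proof. by rewrite /csub_norm linearZ normrZ. Qed.

Lemma csub_norm_eq0 x : csub_norm x = 0 -> x = 0.
Proof. by move=> /normr0_eq0 x0; apply: val_inj; rewrite raddf0. Qed.

HB.instance Definition _ := @Lmodule_isNormed.Build K csubType
  csub_norm csub_normD csub_normZ csub_norm_eq0.

End CsubType.
Coercion csubType : closedSubspace >-> Sortclass.

Section Operators.
Context {R : realType}.
Local Notation C := R[i].

Definition rnorm (V : normedModType C) (x : V) : R := complex.Re `|x|.

(* Operator norm; meaningful for bounded linear F (sup is 0 on unbounded
   sets). *)
Definition opnorm (V W : normedModType C) (F : V -> W) : R :=
  sup [set rnorm (F x) | x in [set x | rnorm x <= 1]].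

Definition power_stable (V : normedModType C) (F : V -> V) (gamma : R) :=
  exists M : R, 1 <= M /\ forall k : nat, opnorm (iter k F) <= M * gamma ^+ k.

Definition resolvent_set (V : normedModType C) (T : V -> V) : set C :=
  [set z | exists S : 'L(V, V),
     (forall x, S (z *: x - T x) = x) /\ (forall x, z *: S x - T (S x) = x)].

Definition spectrum (V : normedModType C) (T : V -> V) : set C :=
  ~` resolvent_set T.

(* On the zero space the spectrum is empty and the spectral radius is
   sup set0 = 0; otherwise, for a bounded operator on a Banach space, the
   spectrum is nonempty and bounded and sup is a genuine supremum. *)
Definition spectral_radius (V : normedModType C) (T : V -> V) : R :=
  sup [set complex.Re `|z| | z in spectrum T].

Section Subspaces.
Context {X : normedModType C}.
Implicit Types P M S : closedSubspace X.

Definition invariant_under (T : X -> X) S := forall x, S x -> S (T x).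

Lemma restrict_op_subproof (T : X -> X) S (TS : invariant_under T S) (x : S) :
  T (csub_val x) \in csub_pred S.
Proof. by apply/asboolP/TS/asboolP; exact: csub_valP. Qed.

Definition restrict_op (T : X -> X) S (TS : invariant_under T S) (x : S) : S :=
  CsubElt (restrict_op_subproof TS x).

Definition finite_dimensional S :=
  exists (n : nat) (b : 'I_n -> S),
    forall x : S, exists c : 'I_n -> C, x = \sum_i c i *: b i.

(* Algebraic, not necessarily orthogonal, direct sum. *)
Definition direct_sum P M :=
  (forall x : X, exists p m, [/\ P p, M m & x = p + m])
  /\ (forall x : X, P x -> M x -> x = 0).

(* The projection onto P along M: when X is the direct sum of P and M, there
   is exactly one p in P with x - p in M, and xget returns it. *)
Definition proj_along P M (x : X) : P :=
  xget 0 [set p : P | M (x - csub_val p)].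

(* w |-> \sum_k w_k Pi x(k) from C^N to P, Pi being the projection onto P
   along M. *)
Definition data_op P M (N : nat) (x : 'I_N -> X) (w : 'rV[C]_N) : P :=
  \sum_k w ord0 k *: proj_along P M (x k).

End Subspaces.

Section Informativity.
Context {X U : hilbertType R} (Xm : closedSubspace X) (gamma_m : R).
Context (N : nat) (x1 x0 : 'I_N -> X) (u0 : 'I_N -> U).

Definition calA : set 'L(X, X) :=
  [set A : 'L(X, X) | exists AXm : invariant_under A Xm,
     spectral_radius (restrict_op AXm) <= gamma_m].

Definition calK : set 'L(X, U) :=
  [set K : 'L(X, U) | forall x, Xm x -> K x = 0].

Definition Sigma_is : set ('L(X, X) * 'L(U, X)) :=
  [set AB : 'L(X, X) * 'L(U, X) |
     calA AB.1 /\ forall k, x1 k = AB.1 (x0 k) + AB.2 (u0 k)].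

Definition Sigma_stab (K : 'L(X, U)) (gamma : R) :
    set ('L(X, X) * 'L(U, X)) :=
  [set AB : 'L(X, X) * 'L(U, X) |
     calA AB.1 /\ power_stable (fun x => AB.1 x + AB.2 (K x)) gamma].

Definition informative (gamma : R) :=
  exists K : 'L(X, U), calK K /\ Sigma_is `<=` Sigma_stab K gamma.

End Informativity.
End Operators.

(* Main.v *)
(* With respect to [X = Xp + Xm] every closed loop [A + B K] is block triangular,
   with diagonal blocks [Pi (A + B K)] on [Xp] and [A] on [Xm].

   (ii) => (i): let [W] be the right inverse and [K := U0 W Pi], where
   [U0 w = \sum_k w_k u0(k)].  The data force the block on [Xp] to be [Xi1 W] for
   every compatible pair [(A, B)], and the block on [Xm] is power bounded with
   any rate above its spectral radius.  The latter is Gelfand's formula, proved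
   here without complex analysis: the resolvent of [T ^ (2 ^ m)] is an average of
   values of the resolvent of [T], hence bounded and Lipschitz uniformly in [m],
   which allows the set of radii [r] with [r ^ n * T ^ n -> 0], [n = 2 ^ m], to be
   enlarged in steps of fixed length.

   (i) => (ii): if some [(p, K p)] were not in the span of the [(Pi x0(k), u0(k))],
   a functional vanishing on that span would yield a rank-one perturbation of
   [(As, Bs)] compatible with the data and with an unstable eigenvalue.  So
   [(p, K p)] is always in the span, and a linear choice of coefficients is the
   right inverse. *)

Require Import Defs.
From HB Require Import structures.
From mathcomp Require Import all_boot all_order all_algebra.
From mathcomp Require Import complex.
From mathcomp Require Import boolp classical_sets functions reals topology.
From mathcomp Require Import normedtype sequences.
From mathcomp Require Import ring lra.

Set Implicit Arguments.
Unset Strict Implicit.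
Unset Printing Implicit Defensive.

Import Order.TTheory GRing.Theory Num.Theory.
Import numFieldNormedType.Exports.

Local Open Scope classical_set_scope.
Local Open Scope ring_scope.

Import Normc.

(** * Bounded operators *)

Section RealNorm.
Context {R : realType}.
Local Notation C := R[i].
Implicit Types V W Y Z : normedModType C.

Lemma normr_rnorm V (x : V) : `|x| = (rnorm x)%:C%C.
Proof. by rewrite RRe_real // ger0_real. Qed.

Lemma rnorm_ge0 V (x : V) : 0 <= rnorm x.
Proof. by rewrite -lecR -normr_rnorm; exact: normr_ge0. Qed.

Lemma rnormD V (x y : V) : rnorm (x + y) <= rnorm x + rnorm y.
Proof. by rewrite -lecR rmorphD /= -!normr_rnorm; exact: ler_normD. Qed.

Lemma normr_normc (a : C) : `|a| = (normc a)%:C%C.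
Proof. by rewrite normc_def; case: a. Qed.

Lemma normc_ge0 (a : C) : 0 <= normc a.
Proof. by rewrite -lecR -normr_normc; exact: normr_ge0. Qed.

Lemma normc_gt0 (a : C) : a != 0 -> 0 < normc a.
Proof.
move=> a0; rewrite lt_neqAle normc_ge0 andbT eq_sym.
by apply: contra a0 => /eqP/eq0_normc ->.
Qed.

Lemma normc_real (r : R) : normc r%:C%C = `|r|.
Proof. by apply: complexI; rewrite -normr_normc normc_def /= expr0n addr0 sqrtr_sqr. Qed.

Lemma rnormZ V (a : C) (x : V) : rnorm (a *: x) = normc a * rnorm x.
Proof. by apply: complexI; rewrite rmorphM /= -!normr_rnorm normrZ normr_normc. Qed.

Lemma rnormN V (x : V) : rnorm (- x) = rnorm x.
Proof. by rewrite /rnorm normrN. Qed.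

Lemma rnormB V (x y : V) : rnorm (x - y) = rnorm (y - x).
Proof. by rewrite -rnormN opprB. Qed.

Lemma rnorm0 V : rnorm (0 : V) = 0.
Proof. by rewrite /rnorm normr0. Qed.

Lemma rnorm0_eq0 V (x : V) : rnorm x = 0 -> x = 0.
Proof. by move=> x0; apply/normr0_eq0; rewrite normr_rnorm x0. Qed.

Lemma rnorm_gt0 V (x : V) : x != 0 -> 0 < rnorm x.
Proof.
move=> x0; rewrite lt_neqAle rnorm_ge0 andbT eq_sym.
by apply: contra x0 => /eqP/rnorm0_eq0 ->.
Qed.

Lemma rnorm_triangle V (x y : V) : rnorm x - rnorm y <= rnorm (x + y).
Proof. by rewrite lerBlDr -{1}(addrK y x) -(rnormN y); exact: rnormD. Qed.

Lemma rnorm_triangleB V (x y : V) : rnorm x - rnorm y <= rnorm (x - y).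
Proof. by rewrite -(rnormN y); exact: rnorm_triangle. Qed.

Lemma rnorm_sum V (I : finType) (f : I -> V) :
  rnorm (\sum_i f i) <= \sum_i rnorm (f i).
Proof.
elim/big_ind2 : _ => [|x a y b xa yb|//]; first by rewrite rnorm0.
exact: le_trans (rnormD _ _) (lerD xa yb).
Qed.

(** Norms take values in [C], where radii of balls are positive elements of [C]; such radii are
    real, which allows all later estimates to be made in [R]. *)
Lemma nbhs_rnormP V (x : V) (P : set V) :
  nbhs x P <-> exists2 e : R, 0 < e & forall y, rnorm (y - x) < e -> P y.
Proof.
split=> [/nbhs_normP[e /= e0 eP]|[e e0 eP]].
  exists (complex.Re e); first by move: e0; rewrite ltcE => /andP[].
  move=> y ye; apply: eP => /=; rewrite distrC normr_rnorm.
  by rewrite -(RRe_real (gtr0_real e0)) ltcR.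
apply/nbhs_normP; exists e%:C%C; first by rewrite /= ltcR.
by move=> y /=; rewrite distrC normr_rnorm ltcR; exact: eP.
Qed.

Definition bounded_by V W (f : V -> W) (c : R) :=
  forall x, rnorm (f x) <= c * rnorm x.

Lemma bounded_by_exists V W (f : V -> W) (c : R) : bounded_by f c ->
  exists2 c', 0 < c' & bounded_by f c'.
Proof.
move=> fc; exists (`|c| + 1); first by rewrite ltr_wpDl.
move=> x; apply: le_trans (fc x) _; apply: ler_wpM2r; first exact: rnorm_ge0.
by rewrite (le_trans (ler_norm c)) // lerDl.
Qed.

Lemma bop_bounded V W (F : 'L(V, W)) : exists2 c, 0 < c & bounded_by F c.
Proof.
have /linear_bounded_continuous/linear_boundedP[M [Mr FM]] :
  continuous (F : {linear V -> W}) by exact: cts_fun.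
exists (`|complex.Re M| + 1); first by rewrite ltr_wpDl.
move=> x; rewrite -lecR rmorphM /= -!normr_rnorm; apply: FM.
rewrite -(RRe_real Mr) ltcR (le_lt_trans (ler_norm _)) // ltrDl //.
Qed.

Lemma linear_bounded_bop V W (f : V -> W) c : linear f -> bounded_by f c ->
  exists F : 'L(V, W), forall x, F x = f x.
Proof.
move=> fl fc.
pose fm := GRing.isLinear.Build _ _ _ _ f fl.
pose g : {linear V -> W} := HB.pack f fm.
have gc : continuous g.
  apply/linear_bounded_continuous/linear_boundedP.
  exists c%:C%C; split; first by rewrite complex_real.
  move=> r cr x.
  apply: le_trans (_ : c%:C%C * `|x| <= _).
    by rewrite !normr_rnorm -rmorphM lecR; exact: fc.
  by apply: ler_wpM2r => //; exact: ltW.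
pose cm := isContinuous.Build _ _ f gc.
by pose F : 'L(V, W) := HB.pack f fm cm; exists F.
Qed.

Lemma opnorm_le V W (f : V -> W) c : 0 <= c -> bounded_by f c -> opnorm f <= c.
Proof.
move=> c0 fc; apply: ge_sup.
  by exists (rnorm (f 0)), 0 => //=; rewrite rnorm0.
move=> _ [x /= x1 <-]; apply: le_trans (fc x) _.
by rewrite -[leRHS]mulr1 ler_wpM2l.
Qed.

(** The bound [c] makes the supremum in [opnorm] genuine rather than the default value 0;
    normalizing [x] uses homogeneity for real scalars. *)
Lemma bounded_by_opnorm V W (f : V -> W) c :
  (forall (a : R) x, f (a%:C%C *: x) = a%:C%C *: f x) -> bounded_by f c ->
  bounded_by f (opnorm f).
Proof.
move=> fZ fc x; have [c' c'0 fc'] := bounded_by_exists fc.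
have ub y : rnorm y <= 1 -> rnorm (f y) <= opnorm f.
  move=> y1; apply: ub_le_sup; last by exists y.
  exists c' => _ [z /= z1 <-]; apply: le_trans (fc' z) _.
  by rewrite -[leRHS]mulr1 ler_wpM2l // ltW.
have [->|x0] := eqVneq x 0; first by move: (fc 0); rewrite rnorm0 !mulr0.
have nx := rnorm_gt0 x0.
have := ub ((rnorm x)^-1%:C%C *: x).
rewrite fZ !rnormZ normc_real ger0_norm ?invr_ge0 ?rnorm_ge0 // mulVf ?gt_eqF //.
by move=> /(_ (lexx _)); rewrite mulrC ler_pdivrMr.
Qed.

Lemma linear_iter V (f : V -> V) k : linear f -> linear (iter k f).
Proof. by move=> fl a x y; elim: k => //= k ->; rewrite fl. Qed.

Lemma bounded_by_iter V (f : V -> V) c k : 0 <= c -> bounded_by f c ->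
  bounded_by (iter k f) (c ^+ k).
Proof.
move=> c0 fc x; elim: k => [|k IHk]; first by rewrite expr0 mul1r.
by rewrite exprS -mulrA; apply: le_trans (fc _) _; apply: ler_wpM2l.
Qed.

Lemma linearPD V W (f : V -> W) x y : linear f -> f (x + y) = f x + f y.
Proof. by move=> fl; have := fl 1 x y; rewrite !scale1r. Qed.

Lemma linearP0 V W (f : V -> W) : linear f -> f 0 = 0.
Proof.
by move=> /(linearPD 0 0)/eqP; rewrite addr0 -subr_eq0 opprD addNKr oppr_eq0 => /eqP.
Qed.

Lemma linearPZ V W (f : V -> W) (a : C) x : linear f -> f (a *: x) = a *: f x.
Proof. by move=> fl; have := fl a x 0; rewrite (linearP0 fl) !addr0. Qed.

Lemma linearPB V W (f : V -> W) x y : linear f -> f (x - y) = f x - f y.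
Proof. by move=> fl; rewrite linearPD // -scaleN1r linearPZ // scaleN1r. Qed.

Lemma linearP_sum V W (f : V -> W) (I : finType) (g : I -> V) : linear f ->
  f (\sum_i g i) = \sum_i f (g i).
Proof.
move=> fl; elim/big_rec2 : _ => [|i a b _ <-]; first exact: linearP0.
exact: linearPD.
Qed.

(** Trades operator norms for pointwise bounds. The requirement [1 <= M] costs nothing, since [M]
    may be replaced by [|M| + 1]. *)
Lemma power_stableP V (f : V -> V) c g : linear f -> bounded_by f c -> 0 < g ->
  power_stable f g <-> exists M, forall k, bounded_by (iter k f) (M * g ^+ k).
Proof.
move=> fl fc g0; split=> [[M [M1 fM]]|[M fM]].
  exists M => k x; have [c' c'0 fc'] := bounded_by_exists fc.
  have fk := bounded_by_iter k (ltW c'0) fc'.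
  apply: le_trans (bounded_by_opnorm _ fk x) _.
    by move=> a y; apply: linearPZ; exact: linear_iter.
  by apply: ler_wpM2r (fM k); exact: rnorm_ge0.
exists (`|M| + 1); split; first by rewrite lerDr.
have gk k : 0 <= g ^+ k by rewrite exprn_ge0 // ltW.
move=> k; apply: opnorm_le => [|x]; first by rewrite mulr_ge0 // addr_ge0.
apply: le_trans (fM k x) _; apply: ler_wpM2r; first exact: rnorm_ge0.
by apply: ler_wpM2r => //; rewrite (le_trans (ler_norm M)) // lerDl.
Qed.

End RealNorm.

(** * Uniform bounds on closed discs by compactness *)

Section Disc.
Context {R : realType}.
Local Notation C := R[i].

Lemma normc_le_sum (z : C) : normc z <= `|complex.Re z| + `|complex.Im z|.
Proof.
case: z => a b /=; rewrite -[leRHS]ger0_norm ?addr_ge0 // -sqrtr_sqr.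
apply: ler_wsqrtr; rewrite sqrrD !real_normK ?num_real //.
by rewrite lerD2r lerDl mulrn_wge0 // mulr_ge0.
Qed.

Lemma normc_ge_ReIm (z : C) :
  `|complex.Re z| <= normc z /\ `|complex.Im z| <= normc z.
Proof.
by case: z => a b /=; rewrite -!sqrtr_sqr; split;
  apply: ler_wsqrtr; rewrite ?lerDl ?lerDr sqr_ge0.
Qed.

(** Compactness: finitely many of the local bounds suffice, and by monotonicity the largest serves
    everywhere. The covering argument runs on a square in [R * R] containing the disc. *)
Lemma disc_locally_uniform (P : C -> R -> Prop) (rho : R) :
  (forall z B B', B <= B' -> P z B -> P z B') ->
  (forall z, normc z <= rho -> exists e B, 0 < e /\
     forall z', normc z' <= rho -> normc (z' - z) < e -> P z' B) ->
  exists B, forall z, normc z <= rho -> P z B.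
Proof.
move=> Pmon Ploc.
have : compact (`[- rho, rho] `*` `[- rho, rho] : set (R * R)).
  by apply: compact_setX; exact: segment_compact.
move=> /compact_near_coveringP/(_ R (pinfty_nbhs R)
  (fun B xy => normc (xy.1 +i* xy.2)%C <= rho -> P (xy.1 +i* xy.2)%C B) _).
case.
- move=> [x y] _; set z := (x +i* y)%C.
  have [e [B [e0 Pe]]] : exists e B, 0 < e /\
     forall z', normc z' <= rho -> normc (z' - z) < e -> P z' B.
    have [/Ploc//|zr] := leP (normc z) rho.
    (* Outside the disc, a ball of this radius misses the disc, so any bound will do. *)
    exists (normc z - rho), 0; split; first by rewrite subr_gt0.
    move=> z' z'r; rewrite ltNge => /negP[]; rewrite lerBlDr.
    apply: le_trans (_ : normc (z' - z) + normc z' <= _); last by rewrite lerD2l.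
    by rewrite -{1}(subKr z' z) -(normcN (z' - z)) addrC; exact: le_normcD.
  have e2 : 0 < e / 2 by rewrite divr_gt0.
  exists (ball (x, y) (e / 2), [set B' | B <= B']) => /=.
    split; first exact: nbhsx_ballx.
    exact/nbhs_pinfty_ge/num_real.
  move=> [[x' y'] B'] /= [[/= xx' yy'] BB'] z'r; apply: Pmon BB' _.
  apply: Pe => //; apply: le_lt_trans (normc_le_sum _) _ => /=.
  rewrite [e]splitr ltrD // distrC //.
- move=> M [_ MP]; exists (M + 1) => z zr.
  have := MP (M + 1) _ (complex.Re z, complex.Im z).
  have -> : (complex.Re z +i* complex.Im z)%C = z by case: z {zr}.
  apply=> //; first by rewrite ltrDl.
  have [zR zI] := normc_ge_ReIm z.
  by split=> /=; rewrite in_itv /= -ler_norml (le_trans _ zr).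
Qed.

End Disc.

Lemma expr_small (R : realType) (q e : R) : 0 <= q < 1 -> 0 < e ->
  exists N, forall n, (N <= n)%N -> q ^+ n <= e.
Proof.
move=> /andP[q0 q1] e0; have := @cvg_expr R q.
rewrite ger0_norm // => /(_ q1)/cvgrPdist_le/(_ e e0)[N _ qN].
exists N => n /qN /=; rewrite sub0r normrN ger0_norm // exprn_ge0 //.
Qed.

(** * Power bounds from the resolvent *)

Section SpectralRadius.
Context {R : realType} {V : normedModType R[i]}.
Local Notation C := R[i].
Variables (T : V -> V) (c : R).
Hypotheses (T_linear : linear T) (c_gt0 : 0 < c) (T_bounded : bounded_by T c).

(** A lower bound for [1 - z T] survives small changes of [z] at the price of doubling the constant;
    compactness of the disc then gives one constant for all [lam]. *)
Lemma resolvent_uniform_bound (rho : R) :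
  (forall lam, normc lam <= rho ->
     exists B, forall y, rnorm y <= B * rnorm (y - lam *: T y)) ->
  exists B, forall lam, normc lam <= rho ->
     forall y, rnorm y <= B * rnorm (y - lam *: T y).
Proof.
move=> res; apply: (disc_locally_uniform
  (P := fun lam B => forall y, rnorm y <= B * rnorm (y - lam *: T y))).
  move=> z B B' BB' zB y; apply: le_trans (zB y) _.
  by apply: ler_wpM2r => //; exact: rnorm_ge0.
move=> z /res[B0 zB0].
have [B B_gt0 zB] : exists2 B, 0 < B & forall y, rnorm y <= B * rnorm (y - z *: T y).
  exists (`|B0| + 1) => [|y]; first by rewrite ltr_wpDl.
  apply: le_trans (zB0 y) _; apply: ler_wpM2r; first exact: rnorm_ge0.
  by rewrite (le_trans (ler_norm B0)) // lerDl.
(* With this radius, [B] times the norm of [(z' - z) T y] is at most half the norm of [y] and is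
   absorbed on the left. *)
exists (2 * B * c)^-1, (2 * B); split; first by rewrite invr_gt0 !mulr_gt0.
move=> z' _ zz' y.
have -> : y - z' *: T y = (y - z *: T y) - (z' - z) *: T y.
  by rewrite scalerBl opprB addrA subrK.
have := rnorm_triangleB (y - z *: T y) ((z' - z) *: T y).
have : rnorm ((z' - z) *: T y) <= (2 * B)^-1 * rnorm y.
  rewrite rnormZ; apply: le_trans (_ : (2 * B * c)^-1 * (c * rnorm y) <= _).
    by apply: ler_pM; rewrite ?normc_ge0 ?rnorm_ge0 // ltW.
  by rewrite mulrA invfM mulfVK ?gt_eqF.
have := zB y; set p := rnorm y; set q := rnorm _; set s := rnorm _; set w := rnorm _.
move=> pq sp qsw.
have : B * s <= p / 2.
  have := ler_wpM2l (ltW B_gt0) sp.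
  by rewrite (_ : B * (_ * p) = p / 2) //; field; rewrite gt_eqF.
have := ler_wpM2l (ltW B_gt0) qsw.
rewrite mulrBr; lra.
Qed.

Variables (B rho : R).
Hypotheses (B_ge0 : 0 <= B)
  (res_bound : forall lam, normc lam <= rho ->
     forall y, rnorm y <= B * rnorm (y - lam *: T y))
  (res_surj : forall lam, normc lam <= rho ->
     forall x, exists y, y - lam *: T y = x).

(** Lipschitz constant of the resolvent along a ray: if [S_r] inverts [1 - r u T], then
    [S_r - S_s = (r - s) u S_r T S_s]. *)
Let L := B * B * c.

(** The operator [u (r T)^(2^m)]. The phase [u] is there because the induction on [m] extracts a
    square root of it at each step. *)
Let dyad m (u : C) (r : R) (x : V) : V :=
  (r%:C%C ^+ (2 ^ m) * u) *: iter (2 ^ m) T x.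

Let dyad_linear m u r : linear (dyad m u r).
Proof.
move=> a x y; rewrite /dyad linear_iter // scalerDr !scalerA; congr (_ *: _ + _).
by rewrite mulrC.
Qed.

Let dyadS m u r x : dyad m.+1 (u * u) r x = dyad m u r (dyad m u r x).
Proof.
rewrite /dyad linearPZ; last exact: linear_iter.
rewrite scalerA -iterD expnS mul2n -addnn exprD; congr (_ *: _); ring.
Qed.

Let dyadN m u r x : dyad m (- u) r x = - dyad m u r x.
Proof. by rewrite /dyad mulrN scaleNr. Qed.

(* Since [1 - a^2 = (1 - a)(1 + a)], the inverse of [1 - a^2] is the average of
   those of [1 - a] and [1 + a]; bounds and Lipschitz constants survive
   averaging, so those of the resolvent hold for all the dyadic powers. *)
Lemma dyadic_resolvent m (u : C) : normc u = 1 ->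
  exists S : R -> V -> V, forall r, 0 <= r <= rho ->
    [/\ forall x, S r x - dyad m u r (S r x) = x,
        forall x, S r (x - dyad m u r x) = x,
        bounded_by (S r) B &
        forall s x, 0 <= s <= rho ->
          rnorm (S r x - S s x) <= L * `|r - s| * rnorm x].
Proof.
elim: m u => [|m IHm] u u1.
  have lam_le r : 0 <= r <= rho -> normc (r%:C%C * u) <= rho.
    by move=> /andP[r0 rr]; rewrite normcM u1 mulr1 normc_real ger0_norm.
  have dyad0 r x : dyad 0 u r x = (r%:C%C * u) *: T x.
    by rewrite /dyad expn0 expr1.
  (* For [r] in the allowed range a solution exists by [res_surj], so the default 0 is never
     returned there. *)
  pose S r x := xget 0 [set y | y - dyad 0 u r y = x].
  have SP r x : 0 <= r <= rho -> S r x - dyad 0 u r (S r x) = x.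
    move=> rr; apply: (@xgetPex _ 0 [set y | y - dyad 0 u r y = x]).
    by have [y yx] := res_surj (lam_le _ rr) x; exists y; rewrite /= dyad0.
  have Sb r : 0 <= r <= rho -> bounded_by (S r) B.
    by move=> rr x; rewrite -{2}(SP r x rr) dyad0; exact/res_bound/lam_le.
  exists S => r rr; split; [by move=> x; exact: SP | | exact: Sb | ].
    move=> x; apply/eqP; rewrite -subr_eq0; apply/eqP/rnorm0_eq0.
    apply/eqP; rewrite eq_le rnorm_ge0 andbT.
    set y := S _ _; have := SP r (x - dyad 0 u r x) rr; rewrite -/y => yx.
    apply: le_trans (res_bound (lam_le _ rr) _) _.
    by rewrite -dyad0 linearPB // opprD addrACA -opprD yx subrr rnorm0 mulr0.
  move=> s x ss; have := SP r x rr; have := SP s x ss.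
  set y := S r x; set z := S s x; rewrite !dyad0 => zx yx.
  have yz : (y - z) - (r%:C%C * u) *: T (y - z) = ((r - s)%:C%C * u) *: T z.
    rewrite linearPB // scalerBr opprD addrACA -opprD yx -zx opprB addrC.
    by rewrite addrA subrK -scalerBl -mulrBl -rmorphB.
  apply: le_trans (res_bound (lam_le _ rr) _) _; rewrite yz rnormZ normcM u1.
  rewrite mulr1 normc_real.
  have : rnorm (T z) <= c * (B * rnorm x).
    by apply: le_trans (T_bounded _) _; apply: ler_wpM2l (Sb _ ss _); exact: ltW.
  move=> /(ler_wpM2l (_ : 0 <= B * `|r - s|))-/(_ (mulr_ge0 B_ge0 (normr_ge0 _))).
  by rewrite /L; congr (_ <= _); ring.
(* With [a = dyad m v r], the operator at level [m.+1] is [a^2]. The induction hypothesis at [v] and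
   at [- v] inverts [1 - a] and [1 + a]. *)
pose v := sqrtC u; have vu : v * v = u by rewrite -expr2 sqrtCK.
have v1 : normc v = 1.
  have /eqP : normc v ^+ 2 = 1 by rewrite expr2 -normcM vu.
  rewrite sqrf_eq1 => /orP[/eqP//|/eqP vN].
  by have := normc_ge0 v; rewrite vN oppr_ge0 ler10.
have [P PP] := IHm v v1.
have [Q QP] := IHm (- v) (etrans (normcN v) v1).
have h2 : (2^-1)%:C%C + (2^-1)%:C%C = 1 :> C.
  by rewrite -rmorphD (_ : 2^-1 + 2^-1 = 1 :> R) //; field.
have hh (x : V) : (2^-1)%:C%C *: (x + x) = x.
  by rewrite scalerDr -scalerDl h2 scale1r.
have rnormh (x : V) : rnorm ((2^-1)%:C%C *: x) = rnorm x / 2.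
  by rewrite rnormZ normc_real ger0_norm ?invr_ge0 // mulrC.
exists (fun r x => (2^-1)%:C%C *: (P r x + Q r x)) => r rr.
have [PI PJ Pb PL] := PP r rr; have [QI QJ Qb QL] := QP r rr.
have dD := linearPD _ _ (dyad_linear m v r).
have dB := linearPB _ _ (dyad_linear m v r).
split.
- move=> x; rewrite (linearPZ _ _ (dyad_linear _ _ _)) -scalerBr -[RHS]hh.
  congr (_ *: _); rewrite -vu dyadS.
  have := QI x; rewrite dyadN opprK => Qx; have Px := PI x.
  set a := dyad m v r in Px Qx dD dB *.
  have ap : a (P r x) = P r x - x by rewrite -{3}Px opprB addrC subrK.
  have aq : a (Q r x) = x - Q r x by rewrite -{2}Qx addrC addKr.
  rewrite dD ap aq addrA subrK dB ap aq opprB.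
  by rewrite opprB [x - _ + _]addrC addrACA !subrKC.
- move=> x; rewrite -vu dyadS.
  set a := dyad m v r in dD dB PJ QJ *.
  have -> : P r (x - a (a x)) = x + a x.
    rewrite -[RHS]PJ -/a; congr (P r _); rewrite dD opprD addrA addrK //.
  have -> : Q r (x - a (a x)) = x - a x.
    rewrite -[RHS]QJ !dyadN -/a; congr (Q r _); by rewrite opprK dB addrA subrK.
  by rewrite addrACA subrr addr0 hh.
- move=> x; rewrite rnormh ler_pdivrMr //.
  apply: le_trans (rnormD _ _) _; rewrite mulr_natr mulr2n.
  by apply: lerD; [exact: Pb | exact: Qb].
- move=> s x ss; rewrite -scalerBr rnormh opprD addrACA ler_pdivrMr //.
  apply: le_trans (rnormD _ _) _; rewrite mulr_natr mulr2n.
  by apply: lerD; [exact: PL | exact: QL].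
Qed.

(** Convergence of [(r T)^(2^m)] to 0 in operator norm. *)
Let decay r := forall e, 0 < e -> exists m0, forall m, (m0 <= m)%N ->
  forall x, r ^+ (2 ^ m) * rnorm (iter (2 ^ m) T x) <= e * rnorm x.

(** Decay at [r] puts the inverse of [1 - (r T)^n], [n = 2^m], close to the identity for large [m].
    The Lipschitz constant does not depend on [m], so the inverse at [r' = r + 2 d] is also close to
    it, which bounds [(r' T)^n] by 1. At the smaller radius [r + d] this becomes decay. *)
Lemma dyadic_decay_step r d : 0 <= r -> 0 < d -> r + 2 * d <= rho ->
  L * (2 * d) <= 4^-1 -> decay r -> decay (r + d).
Proof.
move=> r0 d0 rd Ld Qr; set r' := r + 2 * d in rd.
have [m0 mP] : exists m0, forall m, (m0 <= m)%N -> forall x,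
    r' ^+ (2 ^ m) * rnorm (iter (2 ^ m) T x) <= rnorm x.
  (* This tolerance is applied to [S r y], of norm at most [B] times that of [y], and leaves a
     factor at most [1/4]. *)
  have B1 : 0 < (4 * (B + 1))^-1 by rewrite invr_gt0 mulr_gt0 // ltr_wpDl.
  have [m0 mP] := Qr _ B1.
  exists m0 => m /mP{}mP x.
  have [S SP] := dyadic_resolvent m (normc1 R).
  have rr : 0 <= r <= rho by rewrite r0 (le_trans _ rd) // lerDl mulr_ge0 // ltW.
  have rr' : 0 <= r' <= rho by rewrite rd addr_ge0 // mulr_ge0 // ltW.
  have [SI _ Sb SL] := SP r rr; have [_ SJ' _ _] := SP r' rr'.
  have dE q y : 0 <= q -> rnorm (dyad m 1 q y) = q ^+ (2 ^ m) * rnorm (iter (2 ^ m) T y).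
    by move=> q0; rewrite /dyad mulr1 rnormZ -rmorphXn normc_real ger0_norm // exprn_ge0.
  rewrite -dE; last by case/andP: rr'.
  set a := dyad m 1 r' x; set y := x - a.
  have yx : S r' y = x by exact: SJ'.
  have h1 : rnorm (x - S r y) <= 4^-1 * rnorm y.
    rewrite rnormB -yx; apply: le_trans (SL _ _ rr') _.
    apply: ler_wpM2r; first exact: rnorm_ge0.
    apply: le_trans Ld; rewrite /r' opprD addrA subrr sub0r normrN ger0_norm //.
    by rewrite mulr_ge0 // ltW.
  have h2 : rnorm (S r y - y) <= 4^-1 * rnorm y.
    have -> : S r y - y = dyad m 1 r (S r y).
      by rewrite -{2}(SI y) opprB addrC subrK.
    rewrite dE //; apply: le_trans (mP _) _.
    apply: le_trans (ler_wpM2l _ (Sb y)) _; first exact: ltW.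
    rewrite mulrA; apply: ler_wpM2r; first exact: rnorm_ge0.
    rewrite invfM -mulrA; apply: ler_piMr; first by rewrite invr_ge0.
    by rewrite ler_pdivrMl ?ltr_wpDl // mulr1 lerDl.
  have h3 : rnorm a <= rnorm (x - S r y) + rnorm (S r y - y).
    have -> : a = (x - S r y) + (S r y - y) by rewrite addrA subrK /y subKr.
    exact: rnormD.
  have h4 : rnorm y <= rnorm x + rnorm a.
    by rewrite -(rnormN a); exact: rnormD.
  (* By [h1], [h2], [h3] the norm of [a] is at most half that of [y]; with [h4] it is at most that
     of [x]. *)
  lra.
move=> e e0; have r'0 : 0 < r' by rewrite ltr_wpDl // mulr_gt0.
pose q := (r + d) / r'.
have q01 : 0 <= q < 1.
  rewrite divr_ge0 ?(ltW r'0) ?addr_ge0 ?(ltW d0) //= ltr_pdivrMr // mul1r.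
  by rewrite /r'; lra.
have [n0 nP] := expr_small q01 e0.
exists (maxn m0 n0) => m; rewrite geq_max => /andP[m0m n0m] x.
have -> : r + d = q * r' by rewrite mulfVK ?gt_eqF.
rewrite exprMn -mulrA; apply: ler_pM.
- by rewrite exprn_ge0 //; case/andP: q01.
- by rewrite mulr_ge0 ?rnorm_ge0 // exprn_ge0 // ltW.
- by apply/nP/(leq_trans n0m)/ltnW/ltn_expl.
- exact: mP.
Qed.

(** Division with remainder: each block of [n] iterations contributes [g ^+ n], and the fewer than
    [n] remaining ones cost at most the constant [h ^+ n]. *)
Lemma iter_power_bound n g : (0 < n)%N -> 0 < g ->
  bounded_by (iter n T) (g ^+ n) ->
  exists M, forall k, bounded_by (iter k T) (M * g ^+ k).
Proof.
move=> n0 g0 Tn; pose h := `|c / g| + 1; exists (h ^+ n).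
have h1 : 1 <= h by rewrite lerDr.
elim/ltn_ind => k IHk; have [nk|kn] := leqP n k.
  move=> x; rewrite -(subnKC nk) iterD; apply: le_trans (Tn _) _.
  rewrite exprD mulrCA -mulrA; apply: ler_wpM2l; first by rewrite exprn_ge0 // ltW.
  by apply: IHk; rewrite ltn_subrL n0 (leq_trans n0 nk).
move=> x; apply: le_trans (bounded_by_iter k (ltW c_gt0) T_bounded x) _.
apply: ler_wpM2r; first exact: rnorm_ge0.
have -> : c ^+ k = (c / g) ^+ k * g ^+ k by rewrite -exprMn mulfVK ?gt_eqF.
apply: ler_wpM2r; first by rewrite exprn_ge0 // ltW.
apply: le_trans (_ : h ^+ k <= _); last by apply: ler_weXn2l => //; exact: ltnW.
by apply: lerXn2r; rewrite ?nnegrE ?divr_ge0 ?addr_ge0 ?(ltW c_gt0) ?(ltW g0) //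
  (le_trans (ler_norm _)) // lerDl.
Qed.

(** Decay is trivial at radius 0, and [K] steps of length [d] carry it to [g^-1]. There a single
    power [n = 2^m] with [T^n] bounded by [g^n] suffices. *)
Lemma power_bounded_of_resolvent g : 0 < g -> g^-1 < rho ->
  exists M, forall k, bounded_by (iter k T) (M * g ^+ k).
Proof.
move=> g0 grho.
have gi0 : 0 < g^-1 by rewrite invr_gt0.
have L0 : 0 <= L by rewrite /L !mulr_ge0 // ltW.
have D0 : 0 < rho - g^-1 by rewrite subr_gt0.
(* For [K >= w] the first term gives [d <= rho - g^-1], room for the overshoot to [r + 2 d] in the
   last step, and the second gives [L * (2 * d) <= 1/4]. *)
pose w := g^-1 / (rho - g^-1) + 8 * L * g^-1.
have w0 : 0 <= w by rewrite addr_ge0 // ?divr_ge0 ?mulr_ge0 // ltW.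
pose K := (Num.truncn w).+1; pose d := g^-1 / K%:R.
have K0 : 0 < K%:R :> R by rewrite ltr0n.
have wK : w <= K%:R by rewrite ltW // truncnS_gt.
have d0 : 0 < d by rewrite divr_gt0.
have d1 : d <= rho - g^-1.
  rewrite ler_pdivrMr // mulrC -ler_pdivrMr //; apply: le_trans wK.
  by rewrite lerDl !mulr_ge0 // ltW.
have d2 : L * (2 * d) <= 4^-1.
  have : 8 * L * g^-1 <= K%:R.
    by apply: le_trans wK; rewrite lerDr divr_ge0 // ltW.
  rewrite -[K%:R]mul1r -ler_pdivrMr // (_ : 8 * L * g^-1 / K%:R = 4 * (L * (2 * d))).
    by move=> ?; lra.
  by rewrite /d; ring.
have Qk k : (k <= K)%N -> decay (d *+ k).
  elim: k => [_|k IHk kK].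
    move=> e e0; exists 0%N => m _ x.
    by rewrite mulr0n expr0n expn_eq0 /= mul0r mulr_ge0 ?rnorm_ge0 // ltW.
  rewrite mulrSr; apply: dyadic_decay_step => //.
  - by rewrite mulrn_wge0 // ltW.
  - have : d *+ k.+1 <= d *+ K by rewrite ler_pMn2l.
    have -> : d *+ K = g^-1 by rewrite -mulr_natr mulfVK ?gt_eqF.
    by rewrite mulrSr; lra.
  - by apply: IHk; exact: ltnW.
have [m0 /(_ _ (leqnn m0)) mP] := Qk K (leqnn K) 1 ltr01.
apply: (@iter_power_bound (2 ^ m0)); rewrite ?expn_gt0 // => x.
have := mP x; rewrite -mulr_natr mulfVK ?gt_eqF // mul1r exprVn.
by rewrite mulrC ler_pdivrMr ?exprn_gt0 // mulrC.
Qed.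

End SpectralRadius.

(** * Closed subspaces and projections *)

Section ClosedSubspaces.
Context {R : realType}.
Local Notation C := R[i].

Section Adjoin.
Context {X : normedModType C}.
Implicit Types M S : closedSubspace X.

Lemma csubD M x y : M x -> M y -> M (x + y).
Proof. by move=> Mx My; rewrite -[x]scale1r; apply: csub_linear. Qed.

Lemma csubZ M a x : M x -> M (a *: x).
Proof. by move=> Mx; rewrite -[_ *: _]addr0; apply: csub_linear => //; exact: csub0. Qed.

Lemma csubN M x : M x -> M (- x).
Proof. by move=> Mx; rewrite -scaleN1r; exact: csubZ. Qed.

Lemma csubB M x y : M x -> M y -> M (x - y).
Proof. by move=> Mx My; apply: csubD => //; exact: csubN. Qed.

Lemma csub_separated M x : ~ M x ->
  exists2 e : R, 0 < e & forall m, M m -> e <= rnorm (x - m).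
Proof.
move=> Mx; have /nbhs_rnormP[e e0 eM] : nbhs x (~` (M : set X)).
  by apply: open_nbhs_nbhs; split=> //; apply: closed_openC; exact: csub_closed.
exists e => // m Mm; rewrite leNgt; apply/negP => xm.
by apply: (eM m) => //; rewrite rnormB.
Qed.

Lemma separated_closed (S : set X) :
  (forall x, ~ S x -> exists2 e : R, 0 < e & forall y, S y -> e <= rnorm (x - y)) ->
  closed S.
Proof.
move=> sep x Sx; apply: contrapT => /sep[e e0 eS].
have [|y [/eS]] := Sx (fun y => rnorm (y - x) < e).
  by apply/nbhs_rnormP; exists e.
by rewrite rnormB leNgt => /negP.
Qed.

(** For [t != 0], [t^-1 x] differs from [b] by an element of [M], so its norm is at least the
    distance from [b] to [M]. *)
Lemma coefficient_bound M b : ~ M b -> exists2 c, 0 < c &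
  forall x t, M (x - t *: b) -> normc t <= c * rnorm x.
Proof.
move=> /csub_separated[e e0 eM]; exists e^-1; first by rewrite invr_gt0.
move=> x t Mx; rewrite ler_pdivlMl //.
have [->|t0] := eqVneq t 0; first by rewrite normc0 mulr0 rnorm_ge0.
have := eM _ (csubN (csubZ t^-1 Mx)).
have -> : b - - (t^-1 *: (x - t *: b)) = t^-1 *: x.
  by rewrite opprK scalerBr scalerA mulVf // scale1r subrKC.
by rewrite rnormZ normcV ler_pdivlMl ?normc_gt0 // mulrC.
Qed.

Let adjoin_set M b : X -> Prop := fun x => exists t, M (x - t *: b).

(** Let [x] lie outside [M + C b]. Points of [M + t b] with [|t|] large have large norm and are far
    from [x]; for [|t| <= rho] the distance from [x - t b] to [M] is bounded below by
    compactness. *)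
Lemma adjoin_closed M b : closed (adjoin_set M b : set X).
Proof.
have [Mb|Mb] := pselect (M b).
  have -> : adjoin_set M b = M.
    apply/funext => x; apply/propext; split=> [[t Mx]|Mx].
      by rewrite -[x](subrK (t *: b)); apply: csubD => //; exact: csubZ.
    by exists 0; rewrite scale0r subr0.
  exact: csub_closed.
apply: separated_closed => x xM.
have [c c0 cM] := coefficient_bound Mb.
(* Beyond this radius [coefficient_bound] makes the norm of the point exceed that of [x] by more
   than 1. *)
pose rho := c * (rnorm x + 1).
have [||B xB] := @disc_locally_uniform R
    (fun t B => forall m, M m -> 1 <= B * rnorm (x - t *: b - m)) rho.
- move=> t B B' BB' tB m Mm; apply: le_trans (tB m Mm) _.
  by apply: ler_wpM2r => //; exact: rnorm_ge0.
- move=> t _; have [|e e0 eM] := @csub_separated M (x - t *: b).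
    by move=> xt; apply: xM; exists t.
  have b1 : 0 < rnorm b + 1 by rewrite ltr_wpDl // rnorm_ge0.
  exists (e / 2 / (rnorm b + 1)), (2 / e); split; first by rewrite !divr_gt0.
  move=> t' _; rewrite ltr_pdivlMr // => tt' m Mm.
  have -> : x - t' *: b - m = (x - t *: b - m) - (t' - t) *: b.
    by rewrite scalerBl opprB [x - t *: b - m]addrAC addrA subrK addrAC.
  have := rnorm_triangleB (x - t *: b - m) ((t' - t) *: b).
  have := eM m Mm; rewrite rnormZ.
  have : normc (t' - t) * rnorm b <= normc (t' - t) * (rnorm b + 1).
    by rewrite ler_wpM2l ?normc_ge0 // lerDl.
  move=> h1 h2 h3; by rewrite mulrAC ler_pdivlMr // mul1r; lra.
have B1 : 0 < `|B| + 1 by rewrite ltr_wpDl.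
exists (`|B| + 1)^-1; first by rewrite invr_gt0.
move=> y [t My]; rewrite -[leLHS]mul1r ler_pdivrMr //.
have [tr|tr] := leP (normc t) rho.
  have := xB t tr _ My; rewrite opprB addrA subrK => /le_trans; apply.
  rewrite [leRHS]mulrC.
  apply: ler_wpM2r; first exact: rnorm_ge0.
  by rewrite (le_trans (ler_norm _)) // lerDl.
have := lt_le_trans tr (cM y t My); rewrite /rho ltr_pM2l // => xy.
have := rnorm_triangleB y x; rewrite rnormB => yx.
apply: le_trans (_ : rnorm (x - y) <= _); first lra.
by rewrite ler_peMr ?rnorm_ge0 // lerDr.
Qed.

Lemma adjoin0 M b : adjoin_set M b 0.
Proof. by exists 0; rewrite scale0r subr0; exact: csub0. Qed.

Lemma adjoin_linear M b a x y :
  adjoin_set M b x -> adjoin_set M b y -> adjoin_set M b (a *: x + y).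
Proof.
move=> [s Mx] [t My]; exists (a * s + t).
by rewrite scalerDl -scalerA opprD addrACA -scalerBr; exact: csub_linear.
Qed.

Definition adjoin M b : closedSubspace X :=
  ClosedSubspace (adjoin0 M b) (@adjoin_linear M b) (@adjoin_closed M b).

(** The [b i] may be dependent modulo [M], so the coefficients are chosen, not determined.
    Induction: choose those of the other vectors modulo [M + C b0], then that of [b0] modulo [M]. *)
Lemma bounded_coefficients n M (b : 'I_n -> X) : exists2 K, 0 <= K &
  forall x, (exists c, M (x - \sum_i c i *: b i)) ->
  exists c, M (x - \sum_i c i *: b i) /\ forall i, normc (c i) <= K * rnorm x.
Proof.
elim: n M b => [|n IHn] M b.
  by exists 0 => // x [c Mx]; exists c; split=> // -[].
pose b0 := b ord0; pose b' i := b (lift ord0 i).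
have [K K0 KP] := IHn (adjoin M b0) b'.
have [k k0 kP] : exists2 k, 0 <= k & forall z, adjoin M b0 z ->
    exists t, M (z - t *: b0) /\ normc t <= k * rnorm z.
  have [Mb|Mb] := pselect (M b0).
    exists 0 => // z [t Mz]; exists 0; rewrite normc0 mul0r scale0r subr0; split=> //.
    by rewrite -[z](subrK (t *: b0)); apply: csubD => //; exact: csubZ.
  have [k k0 kP] := coefficient_bound Mb.
  by exists k; [exact: ltW | move=> z [t Mz]; exists t; split=> //; exact: kP].
(* Once the other terms are subtracted from [x], the remainder has norm at most [s] times that of
   [x]. *)
pose s := 1 + \sum_i K * rnorm (b' i).
have s1 : 1 <= s.
  by rewrite lerDl sumr_ge0 // => i _; rewrite mulr_ge0 ?rnorm_ge0.
exists (K + k * s); first by rewrite addr_ge0 // mulr_ge0 // (le_trans _ s1).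
move=> x [c Mx].
have [|c' [[t0 Mz0] c'K]] := KP x.
  exists (fun i => c (lift ord0 i)), (c ord0).
  by move: Mx; rewrite big_ord_recl opprD addrA addrAC.
have [t [Mz tk]] := kP _ (ex_intro _ t0 Mz0).
exists (fun i => if unlift ord0 i is Some j then c' j else t); split.
  rewrite big_ord_recl unlift_none opprD addrA addrAC.
  by under eq_bigr => i _ do rewrite liftK.
move=> i; rewrite mulrDl; case: unliftP => [j _|_].
  apply: le_trans (c'K j) _; rewrite lerDl !mulr_ge0 ?rnorm_ge0 //.
  by rewrite (le_trans _ s1).
apply: le_trans tk _; rewrite -mulrA ler_wpDl ?mulr_ge0 ?rnorm_ge0 //.
apply: ler_wpM2l => //; rewrite mulrDl mul1r.
apply: le_trans (rnormD _ _) _; rewrite rnormN lerD2l.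
apply: le_trans (rnorm_sum _) _; rewrite mulr_suml; apply: ler_sum => j _.
by rewrite rnormZ mulrAC; apply: ler_wpM2r; [exact: rnorm_ge0 | exact: c'K].
Qed.

End Adjoin.

Lemma csub_valS (X : normedModType C) (S : closedSubspace X) (s : S) : S (csub_val s).
Proof. by apply/asboolP; exact: csub_valP. Qed.

Lemma csub_val_linear (X : normedModType C) (S : closedSubspace X) :
  linear (@csub_val _ _ S : S -> X).
Proof. by move=> a x y; exact: (linearP (\val : S -> X)). Qed.

(** * The projection onto [Xp] along [Xm] and its boundedness *)

Section Projection.
Context {X : normedModType C} (Xp Xm : closedSubspace X).
Hypotheses (X_sum : direct_sum Xp Xm) (Xp_fin : finite_dimensional Xp).

Local Notation Pi := (proj_along Xp Xm).

Lemma proj_alongP x : Xm (x - csub_val (Pi x)).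
Proof.
apply: (@xgetPex _ 0 [set p : Xp | Xm (x - csub_val p)]).
have [p [m [Xpp Xmm ->]]] := X_sum.1 x.
have pP : p \in csub_pred Xp by apply/asboolP.
by exists (CsubElt pP); rewrite /= addrC addKr.
Qed.

Lemma proj_along_unique x (p : Xp) : Xm (x - csub_val p) -> Pi x = p.
Proof.
move=> xp; apply: val_inj; apply/eqP; rewrite -subr_eq0; apply/eqP.
apply: X_sum.2; first by apply: csubB; exact: csub_valS.
have -> : \val (Pi x) - \val p = (x - csub_val p) - (x - csub_val (Pi x)).
  by rewrite opprB [RHS]addrC addrA subrK.
by apply: csubB => //; exact: proj_alongP.
Qed.

Lemma proj_along_id (p : Xp) : Pi (csub_val p) = p.
Proof. by apply: proj_along_unique; rewrite subrr; exact: csub0. Qed.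

Lemma proj_along_eq0 m : Xm m -> Pi m = 0.
Proof. by move=> mm; apply: proj_along_unique; rewrite (linearP0 (@csub_val_linear _ Xp)) subr0. Qed.

Lemma proj_along_linear : linear Pi.
Proof.
move=> a x y; apply: proj_along_unique; rewrite csub_val_linear opprD addrACA -scalerBr.
by apply: csub_linear; exact: proj_alongP.
Qed.

(** Modulo [Xm], every [x] is a combination of a finite spanning family of [Xp] with coefficients
    bounded by the norm of [x]. The case [f = id] bounds the projection itself, without the closed
    graph theorem. *)
Lemma bounded_linear_proj_along (W : normedModType C) (f : Xp -> W) : linear f ->
  exists2 c, 0 <= c & bounded_by (f \o Pi) c.
Proof.
move=> fl; have [n [b bP]] := Xp_fin.
have [K K0 KP] := bounded_coefficients Xm (fun i => csub_val (b i)).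
exists (\sum_i K * rnorm (f (b i))).
  by rewrite sumr_ge0 // => i _; rewrite mulr_ge0 ?rnorm_ge0.
move=> x.
have val_sum (c : 'I_n -> C) :
    \sum_i c i *: csub_val (b i) = csub_val (\sum_i c i *: b i).
  rewrite (linearP_sum _ (@csub_val_linear _ _)); apply: eq_bigr => i _.
  by rewrite (linearPZ _ _ (@csub_val_linear _ _)).
have [|c [xc cK]] := KP x.
  by have [c xc] := bP (Pi x); exists c; rewrite val_sum -xc; exact: proj_alongP.
rewrite /= (_ : Pi x = \sum_i c i *: b i); last first.
  by apply: proj_along_unique; rewrite -val_sum.
rewrite linearP_sum //; apply: le_trans (rnorm_sum _) _; rewrite mulr_suml.
apply: ler_sum => i _; rewrite linearPZ // rnormZ mulrAC.
by apply: ler_wpM2r; [exact: rnorm_ge0 | exact: cK].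
Qed.

Lemma proj_along_bounded : exists2 c, 0 <= c & bounded_by Pi c.
Proof. by apply: (@bounded_linear_proj_along _ id) => a x y. Qed.

Lemma fin_linear_bounded (W : normedModType C) (f : Xp -> W) : linear f ->
  exists2 c, 0 <= c & bounded_by f c.
Proof.
move=> /bounded_linear_proj_along[c c0 fc]; exists c => // p.
by rewrite -{1}[p]proj_along_id; exact: fc.
Qed.

End Projection.

End ClosedSubspaces.

(** * Neumann series and the spectral radius *)

Section Resolvent.
Context {R : realType}.
Local Notation C := R[i].

Lemma rnorm_complete (X : completeNormedModType C) (s : nat -> X) :
  (forall e, 0 < e -> exists N, forall n, (N <= n)%N -> rnorm (s n - s N) < e) ->
  exists y, forall e, 0 < e -> exists N, forall n, (N <= n)%N -> rnorm (s n - y) < e.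
Proof.
move=> sC; have : cvg (s @ \oo).
  apply: cauchy_cvg; apply: cauchy_exP => e e0.
  have [|N sN] := sC (complex.Re e); first by move: e0; rewrite ltcE => /andP[].
  exists (s N); exists N => // n /= /sN; rewrite -ball_normE /= distrC.
  by rewrite normr_rnorm -{2}(RRe_real (gtr0_real e0)) ltcR.
move=> /cvg_ex[y sy]; exists y => e e0.
have [N _ sN] := sy [set z | rnorm (z - y) < e]
  ((nbhs_rnormP _ _).2 (ex_intro2 _ _ e e0 (fun z ze => ze))).
by exists N => n /sN.
Qed.

Section Neumann.
Context {X : completeNormedModType C} (S : closedSubspace X).
Variables (A : X -> X) (c : R) (z : C).
Hypotheses (A_linear : linear A) (c_ge0 : 0 <= c) (A_bounded : bounded_by A c)
  (AS : invariant_under A S) (zc : c < normc z).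

Lemma lower_bound_of_large x : (normc z - c) * rnorm x <= rnorm (z *: x - A x).
Proof.
apply: le_trans (rnorm_triangleB _ _); rewrite rnormZ mulrBl lerD2l lerN2.
exact: A_bounded.
Qed.

(** Fixed point iteration for [y = z^-1 (x + A y)], a contraction with factor [c / |z|]. The
    iterates stay in [S] and converge in [X]; closedness puts the limit in [S]. *)
Lemma neumann x : S x -> exists y, S y /\ z *: y - A y = x.
Proof.
move=> Sx; have z0 : 0 < normc z by exact: le_lt_trans zc.
have nz0 : z != 0 by apply: contraTneq z0 => ->; rewrite normc0 ltxx.
pose s n := iter n (fun y => z^-1 *: (x + A y)) 0.
have Ss n : S (s n).
  elim: n => [|n IHn] /=; first exact: csub0.
  by apply/csubZ/csubD => //; exact: AS.
have sS n : z *: s n.+1 = x + A (s n).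
  by rewrite /= scalerA divff // scale1r.
have diffS m n : normc z * rnorm (s m.+1 - s n.+1) <= c * rnorm (s m - s n).
  rewrite -rnormZ scalerBr !sS opprD addrACA subrr add0r -(linearPB _ _ A_linear).
  exact: A_bounded.
(* The solution of [|z| K = |x| + c K], a bound preserved by the iteration. *)
pose K := rnorm x / (normc z - c).
have K0 : 0 <= K by rewrite divr_ge0 ?rnorm_ge0 // subr_ge0 ltW.
have sK n : rnorm (s n) <= K.
  elim: n => [|n IHn]; first by rewrite rnorm0.
  rewrite -(ler_pM2l z0) -rnormZ sS; apply: le_trans (rnormD _ _) _.
  have -> : normc z * K = rnorm x + c * K.
    by rewrite /K; field; rewrite subr_eq0 gt_eqF.
  rewrite lerD2l; apply: le_trans (A_bounded _) _; exact: ler_wpM2l.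
pose q := c / normc z.
have q01 : 0 <= q < 1 by rewrite divr_ge0 ?normc_ge0 //= ltr_pdivrMr // mul1r.
have sq n k : rnorm (s (n + k)%N - s n) <= q ^+ n * K.
  elim: n => [|n IHn]; first by rewrite add0n /= subr0 expr0 mul1r.
  rewrite -(ler_pM2l z0) addSn; apply: le_trans (diffS _ _) _.
  rewrite (_ : normc z * (q ^+ n.+1 * K) = c * (q ^+ n * K)); last first.
    by rewrite exprS /q; field; rewrite gt_eqF.
  exact: ler_wpM2l.
have [e e0|y ys] := @rnorm_complete X s.
  have [N qN] := @expr_small R q (e / (K + 1)) q01 (divr_gt0 e0 (ltr_wpDl K0 ltr01)).
  exists N => n Nn; rewrite -(subnKC Nn); apply: le_lt_trans (sq _ _) _.
  apply: le_lt_trans (ler_wpM2r K0 (qN N (leqnn N))) _.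
  by rewrite mulrAC ltr_pdivrMr ?ltr_wpDl // ltr_pM2l // ltrDl.
exists y; split.
  apply: contrapT => /csub_separated[e e0 eS].
  have [N /(_ N (leqnn N))] := ys e e0.
  by rewrite rnormB ltNge eS.
apply/eqP; rewrite -subr_eq0; apply/eqP/rnorm0_eq0/eqP.
rewrite eq_le rnorm_ge0 andbT; apply/ler_addgt0Pl => e e0; rewrite addr0.
have zc0 : 0 < normc z + c by rewrite ltr_pwDl.
have [N yN] := ys (e / (normc z + c)) (divr_gt0 e0 zc0).
have -> : z *: y - A y - x = A (s N - y) - z *: (s N.+1 - y).
  by rewrite scalerBr sS linearPB // opprB [RHS]addrC addrA opprD !addrA subrK addrAC.
apply: le_trans (rnormD _ _) _; rewrite rnormN rnormZ.
have h1 := ltW (yN N (leqnn N)); have h2 := ltW (yN N.+1 (leqnSn N)).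
have := lerD (le_trans (A_bounded _) (ler_wpM2l c_ge0 h1)) (ler_wpM2l (ltW z0) h2).
by move=> /le_trans; apply; rewrite -mulrDl addrC mulrC mulfVK ?gt_eqF.
Qed.

End Neumann.

Lemma resolvent_setP (V : normedModType C) (T : V -> V) (z : C) d : linear T ->
  0 < d -> (forall y, d * rnorm y <= rnorm (z *: y - T y)) ->
  (forall x, exists y, z *: y - T y = x) -> resolvent_set T z.
Proof.
move=> Tl d0 Td /choice[f fP].
pose Z y := z *: y - T y.
have ZB x y : Z (x - y) = Z x - Z y.
  by rewrite /Z (linearPB _ _ Tl) scalerBr !opprD addrACA.
have Zinj x y : Z x = Z y -> x = y.
  move=> xy; apply/eqP; rewrite -subr_eq0; apply/eqP/rnorm0_eq0/eqP.
  rewrite eq_le rnorm_ge0 andbT -(ler_pM2l d0) mulr0.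
  by apply: le_trans (Td _) _; rewrite -/(Z _) ZB xy subrr rnorm0.
have fl : linear f.
  move=> a x y; apply: Zinj; rewrite [LHS]fP /Z Tl.
  by rewrite scalerDr opprD addrACA fP scalerA mulrC -scalerA -scalerBr fP.
have fb : bounded_by f d^-1.
  by move=> x; rewrite -{2}(fP x) ler_pdivlMl.
have [F FE] := linear_bounded_bop fl fb.
exists F; split=> x; rewrite !FE; last exact: fP.
by apply: Zinj; exact: fP.
Qed.

(** The upper half of Gelfand's formula. Since [1 - lam T = lam (lam^-1 - T)], points outside the
    spectral disc give inverses of [1 - lam T] on a disc of radius larger than [g^-1]. *)
Lemma power_bounded_of_spectral_radius (V : normedModType C) (T : V -> V) c r g :
  linear T -> 0 < c -> bounded_by T c ->
  (forall z, c < normc z -> resolvent_set T z) ->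
  0 < r -> spectral_radius T <= r -> r < g ->
  exists M, forall k, bounded_by (iter k T) (M * g ^+ k).
Proof.
move=> Tl c0 Tc Tlarge r0 Tr rg.
have res z : r < normc z -> resolvent_set T z.
  move=> rz; apply: contrapT => zT; move: rz; rewrite ltNge => /negP; apply.
  apply: le_trans Tr; apply: ub_le_sup; last first.
    by exists z => //; rewrite normr_normc.
  (* The spectrum is bounded by [c], so the supremum defining the spectral radius is genuine. *)
  exists c => _ [w wT <-]; rewrite normr_normc /= leNgt; apply/negP => /Tlarge.
  exact: wT.
(* Strictly between [r] and [g]: on the disc of radius [r'^-1], nonzero [lam] have
   [|lam^-1| >= r' > r], while [g^-1 < r'^-1]. *)
pose r' := (r + g) / 2.
have [rr' r'g] : r < r' /\ r' < g by rewrite /r'; split; lra.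
have r'0 : 0 < r' := lt_trans r0 rr'.
have resV lam : normc lam <= r'^-1 -> lam != 0 -> resolvent_set T lam^-1.
  move=> lr l0; apply: res; apply: lt_le_trans rr' _.
  by rewrite normcV -[r']invrK lef_pV2 ?posrE ?invr_gt0 ?normc_gt0.
have lamE lam y : lam != 0 -> y - lam *: T y = lam *: (lam^-1 *: y - T y).
  by move=> l0; rewrite scalerBr scalerA divff // scale1r.
have [lam lr|B TB] := @resolvent_uniform_bound R V T c c0 Tc r'^-1.
  have [->|l0] := eqVneq lam 0; first by exists 1 => y; rewrite scale0r subr0 mul1r.
  have [S [SI _]] := resV lam lr l0; have [k k0 Sk] := bop_bounded S.
  exists (k * normc lam^-1) => y; rewrite -{1}(SI y) -mulrA -rnormZ lamE //.
  by rewrite scalerA mulVf // scale1r; exact: Sk.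
apply: (@power_bounded_of_resolvent R V T c Tl c0 Tc `|B| r'^-1) => //.
- move=> lam lr y; apply: le_trans (TB lam lr y) _.
  by apply: ler_wpM2r; [exact: rnorm_ge0 | exact: ler_norm].
- move=> lam lr x; have [->|l0] := eqVneq lam 0.
    by exists x; rewrite scale0r subr0.
  have [S [_ SI]] := resV lam lr l0; exists (S (lam^-1 *: x)).
  by rewrite lamE // SI scalerA divff // scale1r.
- exact: lt_trans r'g.
- by rewrite ltf_pV2 // posrE (lt_trans r'0).
Qed.

Lemma restrict_op_linear (X : normedModType C) (A : X -> X) (S : closedSubspace X)
  (AS : invariant_under A S) : linear A -> linear (restrict_op AS).
Proof.
move=> Al a x y; apply: val_inj.
transitivity (a *: A (csub_val x) + A (csub_val y)).
  by rewrite -Al -csub_val_linear.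
exact/esym/(csub_val_linear a (restrict_op AS x)).
Qed.

Lemma power_bounded_restrict (X : completeNormedModType C) (S : closedSubspace X)
  (A : 'L(X, X)) (AS : invariant_under A S) r g :
  0 < r -> spectral_radius (restrict_op AS) <= r -> r < g ->
  exists M, forall k x, S x -> rnorm (iter k A x) <= M * g ^+ k * rnorm x.
Proof.
move=> r0 ASr rg; have [c c0 Ac] := bop_bounded A.
have Al : linear A := linearP A.
have Tl := restrict_op_linear AS Al.
have Tc : bounded_by (restrict_op AS) c by move=> x; exact: Ac.
have Tlarge z : c < normc z -> resolvent_set (restrict_op AS) z.
  move=> cz; apply: (@resolvent_setP _ _ _ (normc z - c)) => //.
  - by rewrite subr_gt0.
  - by move=> y; exact: (lower_bound_of_large _ Ac).
  - move=> x; have [y [Sy yx]] := neumann Al (ltW c0) Ac AS cz (csub_valS x).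
    have yS : y \in csub_pred S by apply/asboolP.
    exists (CsubElt yS); apply: val_inj; rewrite -[RHS]yx.
    rewrite [LHS](linearPB _ _ (@csub_val_linear _ _ S)).
    by rewrite (linearPZ _ _ (@csub_val_linear _ _ S)).
have [M TM] := power_bounded_of_spectral_radius Tl c0 Tc Tlarge r0 ASr rg.
exists M => k x Sx; have xS : x \in csub_pred S by apply/asboolP.
have -> : iter k A x = csub_val (iter k (restrict_op AS) (CsubElt xS)).
  by elim: k => //= k ->.
exact: (TM k (CsubElt xS)).
Qed.

End Resolvent.

(** * Orthogonal residuals and linear sections *)

Section LinearAlgebra.
Context {R : realType}.
Local Notation C := R[i].

Section Residual.
Variables (H : lmodType C) (ip : H -> H -> C).
Hypotheses (ip_linear : forall a x y z, ip (a *: x + y) z = a * ip x z + ip y z)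
  (ip_sym : forall x y, ip y x = (ip x y)^*)
  (ip_definite : forall x, ip x x = 0 -> x = 0).

Let ip0 z : ip 0 z = 0.
Proof.
have := ip_linear 1 0 0 z; rewrite scale1r addr0 mul1r => /eqP.
by rewrite -subr_eq0 opprD addNKr oppr_eq0 => /eqP.
Qed.

Let ipD x y z : ip (x + y) z = ip x z + ip y z.
Proof. by have := ip_linear 1 x y z; rewrite scale1r mul1r. Qed.

Let ipZ a x z : ip (a *: x) z = a * ip x z.
Proof. by have := ip_linear a x 0 z; rewrite ip0 !addr0. Qed.

Let ip_sum n (c : 'I_n -> C) v z : ip (\sum_i c i *: v i) z = \sum_i c i * ip (v i) z.
Proof.
elim/big_rec2 : _ => [|i a b _ <-]; first exact: ip0.
by rewrite ipD ipZ.
Qed.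

(** One Gram-Schmidt step per vector: [e] and [h] are the residuals of [v0] and [x] against the
    other vectors, and the component of [h] along [e] is removed. *)
Lemma orthogonal_residual n (v : 'I_n -> H) x :
  exists c, forall k, ip (v k) (x - \sum_i c i *: v i) = 0.
Proof.
elim: n v x => [|n IHn] v x; first by exists (fun=> 0) => -[].
pose v0 := v ord0; pose v' i := v (lift ord0 i).
have [c cP] := IHn v' v0; have [d dP] := IHn v' x.
set e := v0 - _ in cP; set h := x - _ in dP.
(* If [ip e e = 0], then [e = 0] by definiteness and orthogonality to [e] is trivial, so dependent
   families are covered. *)
pose s := ip h e / ip e e.
have ipB z y : ip z (h - s *: y) = (ip h z - s * ip y z)^*.
  by rewrite ip_sym -scaleNr addrC ip_linear mulNr addrC.
exists (fun i => if unlift ord0 i is Some j then d j - s * c j else s).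
have -> : x - \sum_i (if unlift ord0 i is Some j then d j - s * c j else s) *: v i
    = h - s *: e.
  rewrite big_ord_recl unlift_none /h /e scalerBr opprB opprD addrCA addrC.
  under eq_bigr => i _ do rewrite liftK scalerBl -scalerA.
  rewrite sumrB -scaler_sumr -/v0 opprB -!addrA; congr (_ + _).
  by rewrite addrCA.
have v'0 k : ip (v' k) (h - s *: e) = 0.
  by rewrite ipB ip_sym dP [ip e _]ip_sym cP conjC0 mulr0 subr0 conjC0.
have e0 : ip e (h - s *: e) = 0.
  have [/ip_definite ee|ee] := eqVneq (ip e e) 0; first by rewrite ee ip0.
  by rewrite ipB /s mulfVK // subrr conjC0.
move=> k; case: (unliftP ord0 k) => [j ->|->]; first exact: v'0.
have v0E : v0 = e + \sum_i c i *: v' i by rewrite subrK.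
by rewrite -/v0 [X in ip X]v0E ipD e0 ip_sum big1 ?addr0 // => i _; rewrite v'0 mulr0.
Qed.

(** The residual [h] of [x] works: [ip x h = ip h h], and this vanishes only if [x] lies in the
    span. *)
Lemma separating_vector n (v : 'I_n -> H) x : (forall c, x <> \sum_i c i *: v i) ->
  exists h, (forall k, ip (v k) h = 0) /\ ip x h != 0.
Proof.
move=> xv; have [c cP] := orthogonal_residual v x.
exists (x - \sum_i c i *: v i); split=> //; set h := x - _.
rewrite -[X in ip X h](subrK (\sum_i c i *: v i)) -/h ipD ip_sum.
rewrite [X in _ + X]big1 ?addr0 => [|i _]; last by rewrite cP mulr0.
by apply: contra_notN (xv c) => /eqP/ip_definite/eqP; rewrite subr_eq0 => /eqP.
Qed.

End Residual.

Section LinearSection.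
Variables (N : nat) (V : lmodType C) (L : {linear 'rV[C]_N -> V}).

(** [V] may be infinite-dimensional, so [L] is not given by a matrix. Its kernel is the row space of
    a matrix of maximal rank among those whose rows lie in the kernel. *)
Lemma kernel_matrix : exists A : 'M[C]_N, forall w : 'rV_N, (w <= A)%MS <-> L w = 0.
Proof.
pose P r := `[< exists A : 'M[C]_N,
  (forall w : 'rV_N, (w <= A)%MS -> L w = 0) /\ \rank A = r >].
have P0 : exists r, P r.
  exists 0%N; apply/asboolP; exists 0; rewrite mxrank0; split=> // w.
  by rewrite submx0 => /eqP ->; rewrite linear0.
have PN r : P r -> (r <= N)%N.
  by move=> /asboolP[A [_ <-]]; exact: rank_leq_row.
case: (ex_maxnP P0 PN) => r /asboolP[A [AL rA]] rmax.
exists A => w; split=> [|Lw]; first exact: AL.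
have P1 : P (\rank (A + w)%MS).
  apply/asboolP; exists (A + w)%MS; split=> // v /sub_addsmxP[[u1 u2] /= ->].
  by rewrite linearD AL ?submxMl // [u2]mx11_scalar mul_scalar_mx linearZ /= Lw scaler0 addr0.
have [_ AA] := mxrank_leqif_sup (addsmxSl A w).
have : (A + w <= A)%MS.
  by rewrite -AA eqn_leq mxrankS ?addsmxSl // rA rmax.
by apply: submx_trans; exact: addsmxSr.
Qed.

(** Pick any preimage and project it by [Q] onto a complement of the kernel, along the kernel. The
    result does not depend on the preimage, hence is linear on the range of [L]. *)
Lemma linear_section : exists s : V -> 'rV[C]_N,
  (forall w, L (s (L w)) = L w) /\
  forall a w w', s (a *: L w + L w') = a *: s (L w) + s (L w').
Proof.
have [A AP] := kernel_matrix; pose Q := proj_mx A^C%MS A.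
have QL (w : 'rV_N) : L (w *m Q) = L w.
  have /AP : (w - w *m Q <= A)%MS.
    apply: proj_mx_compl_sub; rewrite addsmxC submx_full //.
    exact: addsmx_compl_full.
  by rewrite linearB => /eqP; rewrite subr_eq0 => /eqP ->.
have Q0 (w : 'rV_N) : L w = 0 -> w *m Q = 0.
  by move=> /AP; apply: proj_mx_0; rewrite capmxC capmx_compl.
pose s v := xget (0 : 'rV_N) [set w | L w = v] *m Q.
have sL w : s (L w) = w *m Q.
  apply/eqP; rewrite -subr_eq0 -mulmxBl; apply/eqP/Q0; rewrite linearB.
  rewrite (@xgetPex _ 0 [set w' | L w' = L w]) ?subrr //; by exists w.
exists s; split=> [w|a w w']; first by rewrite sL QL.
by rewrite -linearP !sL mulmxDl scalemxAl.
Qed.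

End LinearSection.

(** Cauchy-Schwarz via Pythagoras: the orthogonal projection [t *: a] of [x] is no longer than
    [x]. *)
Lemma inner_bounded (X : hilbertType R) (a x : X) :
  normc (inner x a) <= rnorm a * rnorm x.
Proof.
have [->|a0] := eqVneq a 0; first by rewrite linear0r rnorm0 mul0r normc0.
have aa : inner a a != 0 by rewrite dnorm_eq0.
pose t := inner x a / inner a a.
have orth : inner (x - t *: a) (t *: a) = 0.
  by rewrite linearZr_LR /= linearBl /= linearZl_LR /= divfK // subrr mulr0.
have : `|t *: a| ^+ 2 <= `|x| ^+ 2.
  rewrite -[X in _ <= `|X| ^+ 2](subrK (t *: a)) !sqr_norm_inner hnormDd //.
  by rewrite lerDr dnorm_ge0.
rewrite !normr_rnorm -!rmorphXn lecR ler_sqr ?nnegrE ?rnorm_ge0 // rnormZ => ta.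
have -> : inner x a = t * inner a a by rewrite divfK.
rewrite normcM -sqr_norm_inner normr_rnorm -rmorphXn normc_real ger0_norm ?exprn_ge0 ?rnorm_ge0 //.
by rewrite expr2 mulrA mulrC ler_wpM2l ?rnorm_ge0.
Qed.

Lemma pair_separating_vector (X U : hilbertType R) n
  (v : 'I_n -> X) (u : 'I_n -> U) (x : X) (y : U) :
  (forall c, ~ (x = \sum_i c i *: v i /\ y = \sum_i c i *: u i)) ->
  exists a b, (forall k, inner (v k) a + inner (u k) b = 0) /\
    inner x a + inner y b != 0.
Proof.
move=> xy.
pose ip (p q : X * U) := inner p.1 q.1 + inner p.2 q.2.
have [a' p q z|p q|p|c xc|[a b] [h0 h1]] :=
    @separating_vector (X * U)%type ip _ _ _ n (fun k => (v k, u k)) (x, y).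
- by rewrite /ip !linearPl /= mulrDr addrACA.
- by rewrite /ip rmorphD /= [inner q.1 _]hermC [inner q.2 _]hermC expr0 !mul1r.
- rewrite /ip -!sqr_norm_inner => /eqP.
  rewrite paddr_eq0 ?exprn_ge0 // !expf_eq0 /= !normr_eq0 => /andP[/eqP p1 /eqP p2].
  by rewrite [p]surjective_pairing p1 p2.
- apply: (xy c); split.
    by rewrite -[x]/((x, y).1) xc (raddf_sum fst).
  by rewrite -[y]/((x, y).2) xc (raddf_sum snd).
- by exists a, b.
Qed.

End LinearAlgebra.

(** * Closed loops *)

Section ClosedLoops.
Context {R : realType}.
Local Notation C := R[i].

(* Variation of constants: the component of [iter k F x] along [Xm] solves
   [m_(k+1) = A m_k + E q_k] with [q_k = iter k G (Pi x)], and
   [\sum_(j < k) g'^(k-1-j) g^j = (g'^k - g^k) / (g' - g)]. *)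
Lemma triangular_power_bound (X : normedModType C) (Xp Xm : closedSubspace X)
  (F A : X -> X) (G : Xp -> Xp) cF M1 M2 g g' :
  direct_sum Xp Xm -> finite_dimensional Xp ->
  linear F -> linear A -> 0 <= cF -> bounded_by F cF -> 0 <= M1 -> 0 <= M2 ->
  0 <= g < g' ->
  (forall m, Xm m -> F m = A m /\ Xm (A m)) ->
  (forall x, proj_along Xp Xm (F x) = G (proj_along Xp Xm x)) ->
  (forall k, bounded_by (iter k G) (M1 * g ^+ k)) ->
  (forall k m, Xm m -> rnorm (iter k A m) <= M2 * g' ^+ k * rnorm m) ->
  exists M, forall k, bounded_by (iter k F) (M * g' ^+ k).
Proof.
move=> X_sum Xp_fin Fl Al cF0 Fc M10 M20 /andP[g0 gg'] FA FG GM AM.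
set Pi := proj_along Xp Xm in FG *.
have [cP cP0 Pic] := proj_along_bounded X_sum Xp_fin.
have g'0 : 0 < g' := le_lt_trans g0 gg'.
have d0 : 0 < g' - g by rewrite subr_gt0.
(* The off-diagonal block, from [Xp] to [Xm]. *)
pose E q := F (csub_val q) - csub_val (G q).
have EXm q : Xm (E q).
  by rewrite /E -[q in G q](proj_along_id X_sum) -FG; exact: proj_alongP.
pose e := cF + M1 * g.
have e0 : 0 <= e by rewrite addr_ge0 // mulr_ge0.
have Ee q : rnorm (E q) <= e * rnorm q.
  rewrite mulrDl; apply: le_trans (rnormD _ _) _; rewrite rnormN.
  apply: lerD; first exact: Fc.
  by have := GM 1%N q; rewrite expr1.
pose s k := (g' ^+ k - g ^+ k) / (g' - g).
have sS k : s k.+1 = g' * s k + g ^+ k.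
  by rewrite /s !exprS; field; rewrite gt_eqF.
exists (M2 * (1 + cP + e * M1 * (g' - g)^-1 * cP) + M1 * cP) => k x.
set q := Pi x; set m0 := x - csub_val q.
have PiF j : Pi (iter j F x) = iter j G q.
  by elim: j => //= j IHj; rewrite FG IHj.
pose m j := iter j F x - csub_val (iter j G q).
have mXm j : Xm (m j) by rewrite /m -PiF; exact: proj_alongP.
have mS j : m j.+1 = A (m j) + E (iter j G q).
  by rewrite -(FA _ (mXm j)).1 /m /E (linearPB _ _ Fl) addrA subrK.
(* The extra [i] iterations of [A] let the induction on [j] use the power bound of [A] as a whole;
   only [i = 0] is needed at the end. *)
have mb j i : rnorm (iter i A (m j)) <=
    M2 * g' ^+ i * (g' ^+ j * rnorm m0 + e * M1 * s j * rnorm q).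
  elim: j i => [|j IHj] i.
    by rewrite /s subrr mul0r mulr0 mul0r addr0 expr0 mul1r; apply: AM; exact: (mXm 0%N).
  rewrite mS linearPD; last exact: linear_iter.
  apply: le_trans (rnormD _ _) _.
  have h1 := IHj i.+1; rewrite iterSr in h1.
  have h2 := AM i _ (EXm (iter j G q)).
  have h3 : M2 * g' ^+ i * rnorm (E (iter j G q)) <=
      M2 * g' ^+ i * (e * (M1 * g ^+ j * rnorm q)).
    apply: ler_wpM2l; first by rewrite mulr_ge0 // exprn_ge0 // ltW.
    by apply: le_trans (Ee _) _; apply: ler_wpM2l => //; exact: GM.
  apply: le_trans (lerD h1 (le_trans h2 h3)) _.
  by rewrite sS !exprS le_eqVlt; apply/orP; left; apply/eqP; ring.
have -> : iter k F x = m k + csub_val (iter k G q) by rewrite subrK.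
have g'k : 0 <= g' ^+ k by rewrite exprn_ge0 // ltW.
have gk : g ^+ k <= g' ^+ k by apply: lerXn2r; rewrite ?nnegrE ?(ltW gg') ?(ltW g'0).
have q1 : rnorm q <= cP * rnorm x by exact: Pic.
have m1 : rnorm m0 <= (1 + cP) * rnorm x.
  rewrite mulrDl mul1r; apply: le_trans (rnormD _ _) _.
  by rewrite rnormN lerD2l.
have s0 : 0 <= s k by apply: divr_ge0; [rewrite subr_ge0 | exact: ltW].
have s1 : s k <= (g' - g)^-1 * g' ^+ k.
  rewrite /s mulrC; apply: ler_wpM2l; first by rewrite invr_ge0 ltW.
  by rewrite gerBl exprn_ge0.
apply: le_trans (rnormD _ _) _; rewrite mulrDl mulrDl; apply: lerD.
  have := mb k 0%N; rewrite expr0 mulr1 => /le_trans; apply.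
  rewrite -!mulrA; apply: ler_wpM2l => //.
  have -> : (1 + cP + e * (M1 * ((g' - g)^-1 * cP))) * (g' ^+ k * rnorm x) =
     g' ^+ k * ((1 + cP) * rnorm x) +
     e * M1 * ((g' - g)^-1 * g' ^+ k) * (cP * rnorm x) by ring.
  apply: lerD; first exact: ler_wpM2l.
  apply: le_trans (_ : e * M1 * (s k * rnorm q) <= _); first by rewrite !mulrA.
  rewrite -[leRHS](mulrA (e * M1)); apply: ler_wpM2l; first exact: mulr_ge0.
  by apply: ler_pM => //; exact: rnorm_ge0.
apply: le_trans (GM k q) _.
rewrite -!mulrA; apply: ler_wpM2l => //; rewrite mulrCA.
by apply: ler_pM => //; [rewrite exprn_ge0 | exact: rnorm_ge0].
Qed.

Lemma data_op_linear (X : normedModType C) (Xp Xm : closedSubspace X) N (x : 'I_N -> X) :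
  linear (data_op Xp Xm x).
Proof.
move=> a v w; rewrite /data_op scaler_sumr -big_split /=; apply: eq_bigr => k _.
by rewrite !mxE scalerDl scalerA.
Qed.

(** Because [A] preserves [Xm], the [Xm] component of [x0 k] does not affect [Pi (A (x0 k))]. The
    data thus fix the action on [Xp] for every compatible pair. *)
Lemma data_op_step (X U : normedModType C) (Xp Xm : closedSubspace X)
  (A : X -> X) (B : U -> X) N (x1 x0 : 'I_N -> X) (u0 : 'I_N -> U) (w : 'rV[C]_N) :
  direct_sum Xp Xm -> linear A -> linear B -> invariant_under A Xm ->
  (forall k, x1 k = A (x0 k) + B (u0 k)) ->
  proj_along Xp Xm (A (csub_val (data_op Xp Xm x0 w))
    + B (\sum_k w ord0 k *: u0 k)) = data_op Xp Xm x1 w.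
Proof.
move=> X_sum Al Bl AXm x1E; have Pl := proj_along_linear X_sum.
rewrite /data_op (linearP_sum _ (@csub_val_linear _ _ Xp)).
rewrite (linearP_sum _ Al) (linearP_sum _ Bl) -big_split (linearP_sum _ Pl).
apply: eq_bigr => k _ /=.
rewrite (linearPZ _ _ Al) (linearPZ _ _ Bl).
rewrite -scalerDr (linearPZ _ _ Pl) x1E; congr (_ *: _).
rewrite !(linearPD _ _ Pl); congr (_ + _).
apply/eqP; rewrite -subr_eq0 -(linearPB _ _ Pl) -(linearPB _ _ Al).
apply/eqP/proj_along_eq0 => //; apply: AXm; rewrite -opprB; apply: csubN.
exact: proj_alongP.
Qed.

Definition csub_full (X : normedModType C) : closedSubspace X :=
  @ClosedSubspace _ X setT I (fun _ _ _ _ _ => I) closedT.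

(* Choose [y = (lam - F)^-1 p] and [t = 1 / chi y]: then
   [F y + t chi y p = lam y], so the perturbed operator has the eigenvalue
   [lam]. *)
Lemma rank_one_eigenvector (X : completeNormedModType C) (F : X -> X) (chi : X -> C) cF cchi p :
  linear F -> 0 <= cF -> bounded_by F cF ->
  (forall x y, chi (x + y) = chi x + chi y) -> (forall a x, chi (a *: x) = a * chi x) ->
  0 <= cchi -> (forall x, normc (chi x) <= cchi * rnorm x) -> chi p != 0 ->
  exists t lam y, [/\ 1 <= normc lam, y != 0 & F y + (t * chi y) *: p = lam *: y].
Proof.
move=> Fl cF0 Fc chiD chiZ cchi0 chic chip.
have chip0 := normc_gt0 chip.
(* Here [|y| <= |p| / D], so [chi (F y)] is smaller than [chi p] and cannot cancel it; this keeps
   [chi y] nonzero. Also [D >= 1] yields [|lam| >= 1]. *)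
pose D := 1 + cchi * cF * rnorm p / normc (chi p).
have D1 : 1 <= D by rewrite lerDl divr_ge0 ?mulr_ge0 ?rnorm_ge0 // ltW.
pose lam : C := (cF + D)%:C%C.
have lamE : normc lam = cF + D.
  by rewrite normc_real ger0_norm // addr_ge0 // (le_trans _ D1).
have cl : cF < normc lam by rewrite lamE ltrDl (lt_le_trans _ D1).
have [|y [_ yp]] := @neumann _ X (csub_full X) F cF lam Fl cF0 Fc _ cl p I.
  by [].
have ly : lam *: y = p + F y by rewrite -yp subrK.
have chiy : chi y != 0.
  apply/eqP => y0; have : chi (lam *: y) = 0 by rewrite chiZ y0 mulr0.
  rewrite ly chiD => /eqP; rewrite addr_eq0 => /eqP chiE.
  have := chic (F y); rewrite -normcN -chiE; apply/negP; rewrite -ltNge.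
  have yD : D * rnorm y <= rnorm p.
    by have := lower_bound_of_large lam Fc y; rewrite yp lamE addrAC subrr add0r.
  have D0 : 0 < D by exact: lt_le_trans D1.
  rewrite -(ltr_pM2l D0); apply: le_lt_trans (_ : cchi * cF * rnorm p < _).
    rewrite mulrCA -mulrA; apply: ler_wpM2l => //.
    apply: le_trans (ler_wpM2l (ltW D0) (Fc y)) _.
    by rewrite mulrCA; apply: ler_wpM2l.
  by rewrite /D mulrDl mul1r mulfVK ?gt_eqF // ltrDr.
exists (chi y)^-1, lam, y; split.
- by rewrite lamE ler_wpDl.
- by apply: contra chiy => /eqP ->; rewrite -(scale0r 0) chiZ mul0r.
- by rewrite mulVf // scale1r ly addrC.
Qed.

Lemma not_power_stable_eigenvector (V : normedModType C) (F : V -> V) c g lam y :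
  linear F -> bounded_by F c -> 0 < g < 1 -> 1 <= normc lam -> y != 0 ->
  F y = lam *: y -> ~ power_stable F g.
Proof.
move=> Fl Fc /andP[g0 g1] lam1 y0 Fy /(power_stableP Fl Fc g0)[M FM].
have ny := rnorm_gt0 y0.
have iterE k : iter k F y = lam ^+ k *: y.
  elim: k => [|k IHk]; first by rewrite expr0 scale1r.
  by rewrite iterS IHk linearPZ // Fy scalerA exprSr.
have normcX k : 1 <= normc (lam ^+ k).
  elim: k => [|k IHk]; first by rewrite expr0 normc1.
  by rewrite exprS normcM -[1]mulr1; apply: ler_pM.
have M1 : 0 < `|M| + 1 by rewrite ltr_wpDl.
have e0 : 0 < (`|M| + 1)^-1 / 2 by rewrite divr_gt0 ?invr_gt0.
have g01 : 0 <= g < 1 by rewrite (ltW g0).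
have [N gN] := expr_small g01 e0.
have := FM N y; rewrite iterE rnormZ ler_pM2r // => MN.
have := le_trans (normcX N) MN; apply/negP; rewrite -ltNge.
apply: le_lt_trans (_ : (`|M| + 1) * ((`|M| + 1)^-1 / 2) < _); last first.
  by rewrite mulrA divff ?gt_eqF // div1r invf_lt1 // ltr1n.
apply: le_trans (_ : (`|M| + 1) * g ^+ N <= _).
  apply: ler_wpM2r; first by rewrite exprn_ge0 // ltW.
  by rewrite (le_trans (ler_norm _)) // lerDl.
by rewrite ler_pM2l // gN.
Qed.

End ClosedLoops.

(** * Informativity and stabilizing right inverses *)

Section Informativity.
Context {R : realType} {X U : hilbertType R}.
Local Notation C := R[i].
Variables (As : 'L(X, X)) (Bs : 'L(U, X)) (N : nat).
Variables (x1 x0 : 'I_N -> X) (u0 : 'I_N -> U).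
Hypothesis (data_As_Bs : forall k, x1 k = As (x0 k) + Bs (u0 k)).
Variables (gamma_m : R) (Xp Xm : closedSubspace X).
Hypotheses (gamma_m0 : 0 < gamma_m) (X_sum : direct_sum Xp Xm)
  (Xp_fin : finite_dimensional Xp)
  (As_Xm : invariant_under As Xm)
  (As_Xm_radius : spectral_radius (restrict_op As_Xm) <= gamma_m).

Local Notation Pi := (proj_along Xp Xm).
Local Notation Xi1 := (data_op Xp Xm x1).
Local Notation Xi0 := (data_op Xp Xm x0).

Lemma closed_loop_linear (A : 'L(X, X)) (B : 'L(U, X)) (K : 'L(X, U)) :
  linear (fun x => A x + B (K x)).
Proof. by move=> a x y; rewrite !linearP scalerDr addrACA. Qed.

Lemma closed_loop_bounded (A : 'L(X, X)) (B : 'L(U, X)) (K : 'L(X, U)) :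
  exists2 c, 0 <= c & bounded_by (fun x => A x + B (K x)) c.
Proof.
have [cA cA0 Ac] := bop_bounded A; have [cB cB0 Bc] := bop_bounded B.
have [cK cK0 Kc] := bop_bounded K.
exists (cA + cB * cK) => [|x]; first by rewrite addr_ge0 ?mulr_ge0 // ltW.
apply: le_trans (rnormD _ _) _; rewrite mulrDl; apply: lerD; first exact: Ac.
by apply: le_trans (Bc _) _; rewrite -mulrA; apply: ler_wpM2l (Kc _); exact: ltW.
Qed.

(** The rate rises from [g] to [g'] for two reasons: the block on [Xm] is power bounded only at
    rates above [gamma_m], and the coupling sum needs [g < g']. *)
Lemma informative_of_right_inverse (W : 'L(Xp, 'rV[C]_N)) g g' :
  gamma_m <= g < g' -> (forall p, Xi0 (W p) = p) ->
  power_stable (Xi1 \o W) g -> informative Xm gamma_m x1 x0 u0 g'.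
Proof.
move=> /andP[mg gg'] WP Wst; pose f p := \sum_k (W p) ord0 k *: u0 k.
have g0 : 0 < g := lt_le_trans gamma_m0 mg.
have fl : linear f.
  move=> a p q; rewrite /f scaler_sumr -big_split /=; apply: eq_bigr => k _.
  by rewrite linearP !mxE scalerDl scalerA.
have Pl := proj_along_linear X_sum.
have [cf _ fc] := bounded_linear_proj_along X_sum Xp_fin fl.
have fPl : linear (f \o Pi) by move=> a x y /=; rewrite Pl fl.
have [K KE] := linear_bounded_bop fPl fc.
exists K; split; first by move=> x xm; rewrite KE /= proj_along_eq0 // (linearP0 fl).
move=> [A B] [/= AX AB]; split=> //=; have [AXm Ar] := AX.
have Fl := closed_loop_linear A B K.
have [cF cF0 Fc] := closed_loop_bounded A B K.
apply/(power_stableP Fl Fc (lt_trans g0 gg')).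
have Gl : linear (Xi1 \o W) by move=> a p q; rewrite /= linearP data_op_linear.
have [cG _ Gc] := fin_linear_bounded X_sum Xp_fin Gl.
have [M1 GM] := (power_stableP Gl Gc g0).1 Wst.
have [M2 AM] := power_bounded_restrict gamma_m0 Ar (le_lt_trans mg gg').
have Al : linear A := linearP A.
have AK m : Xm m -> A m + B (K m) = A m /\ Xm (A m).
  move=> mm; rewrite KE /= proj_along_eq0 // (linearP0 fl) linear0 addr0.
  by split=> //; exact: (AXm _ mm).
apply: (@triangular_power_bound R X Xp Xm _ A (Xi1 \o W) cF `|M1| `|M2| g g') => //.
- by rewrite ltW.
- move=> x; rewrite /= -(data_op_step (W (Pi x)) X_sum Al (linearP B) AXm AB) WP KE.
  rewrite !(linearPD _ _ Pl); congr (_ + _); apply/eqP.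
  rewrite -subr_eq0 -(linearPB _ _ Pl) -(linearPB _ _ Al).
  by apply/eqP/proj_along_eq0 => //; apply: (AXm _); exact: proj_alongP.
- move=> k p; apply: le_trans (GM k p) _; apply: ler_wpM2r; first exact: rnorm_ge0.
  by apply: ler_wpM2r; [rewrite exprn_ge0 // ltW | exact: ler_norm].
- move=> k m mm; apply: le_trans (AM k m mm) _.
  apply: ler_wpM2r; first exact: rnorm_ge0.
  apply: ler_wpM2r; last exact: ler_norm.
  by rewrite exprn_ge0 // ltW // (lt_trans g0).
Qed.

(** Otherwise a pair [(a, b)] annihilates all data [(Pi x0(k), u0(k))] but not [(p, K p)], and a
    destabilizing perturbation in the direction [p] is invisible to the data. *)
Lemma data_span_graph (K : 'L(X, U)) g (p : Xp) : gamma_m <= g < 1 ->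
  Sigma_is Xm gamma_m x1 x0 u0 `<=` Sigma_stab Xm gamma_m K g ->
  calK Xm K ->
  exists w : 'rV[C]_N, Xi0 w = p /\ \sum_k w ord0 k *: u0 k = K (csub_val p).
Proof.
move=> /andP[mg g1] stab KXm; apply: contrapT => nw.
have Pl := proj_along_linear X_sum.
have [|a [b [ab0 abp]]] := @pair_separating_vector R X U N
    (fun k => csub_val (Pi (x0 k))) u0 (csub_val p) (K (csub_val p)).
  move=> c [pc Kc]; apply: nw; exists (\row_k c k).
  split; last by rewrite Kc; apply: eq_bigr => k _; rewrite mxE.
  apply: val_inj; rewrite -[RHS]/(csub_val p) pc -[LHS]/(csub_val _) /data_op.
  rewrite (linearP_sum _ (@csub_val_linear _ _ Xp)); apply: eq_bigr => k _.
  by rewrite (linearPZ _ _ (@csub_val_linear _ _ Xp)) mxE.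
pose phi x := inner (csub_val (Pi x)) a.
(* The functional [(a, b)] evaluated along the graph of the feedback, so that perturbing [As] by
   [t phi p] and [Bs] by [t inner(., b) p] perturbs the closed loop by [t chi p]. *)
pose chi x := phi x + inner (K x) b.
have phiP s x y : phi (s *: x + y) = s * phi x + phi y.
  by rewrite /phi Pl csub_val_linear linearPl.
have innP s (x y : U) : inner (s *: x + y) b = s * inner x b + inner y b.
  by rewrite linearPl.
have chiP s x y : chi (s *: x + y) = s * chi x + chi y.
  by rewrite /chi phiP linearP innP mulrDr addrACA.
have chi0 : chi 0 = 0 by have := chiP (-1) 0 0; rewrite scaleN1r oppr0 addr0 mulN1r addNr.
have [cP cP0 Pc] := proj_along_bounded X_sum Xp_fin.
have [cK cK0 Kc] := bop_bounded K.
have phic x : normc (phi x) <= rnorm a * cP * rnorm x.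
  apply: le_trans (inner_bounded _ _) _; rewrite -mulrA.
  by apply: ler_wpM2l; [exact: rnorm_ge0 | exact: Pc].
have chic x : normc (chi x) <= (rnorm a * cP + rnorm b * cK) * rnorm x.
  apply: le_trans (le_normcD _ _) _; rewrite mulrDl; apply: lerD; first exact: phic.
  apply: le_trans (inner_bounded _ _) _; rewrite -mulrA.
  by apply: ler_wpM2l; [exact: rnorm_ge0 | exact: Kc].
have Fl := closed_loop_linear As Bs K.
have [cF cF0 Fc] := closed_loop_bounded As Bs K.
have chiD x y : chi (x + y) = chi x + chi y.
  by have := chiP 1 x y; rewrite scale1r mul1r.
have chiZ s x : chi (s *: x) = s * chi x by have := chiP s x 0; rewrite chi0 !addr0.
have cchi0 : 0 <= rnorm a * cP + rnorm b * cK.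
  by rewrite addr_ge0 // mulr_ge0 ?rnorm_ge0 // ltW.
have chip : chi (csub_val p) != 0 by rewrite /chi /phi proj_along_id.
have [t [lam [y [lam1 y0 Fy]]]] :=
  rank_one_eigenvector Fl cF0 Fc chiD chiZ cchi0 chic chip.
have A0l : linear (fun x => As x + (t * phi x) *: csub_val p).
  move=> s x z; rewrite linearP phiP scalerDr !scalerA addrACA -scalerDl mulrDr.
  by rewrite mulrCA.
have [cA _ Ac] := bop_bounded As; have [cB _ Bc] := bop_bounded Bs.
have A0c : bounded_by (fun x => As x + (t * phi x) *: csub_val p)
    (cA + normc t * (rnorm a * cP) * rnorm (csub_val p)).
  move=> x; apply: le_trans (rnormD _ _) _; rewrite mulrDl; apply: lerD; first exact: Ac.
  rewrite rnormZ normcM -!mulrA; apply: ler_wpM2l; first exact: normc_ge0.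
  have := ler_wpM2r (rnorm_ge0 (csub_val p)) (phic x).
  by rewrite -!mulrA [rnorm x * _]mulrC.
have [A' A'E] := linear_bounded_bop A0l A0c.
have B0l : linear (fun u => Bs u + (t * inner u b) *: csub_val p).
  move=> s x z; rewrite linearP innP scalerDr !scalerA addrACA -scalerDl mulrDr.
  by rewrite mulrCA.
have B0c : bounded_by (fun u => Bs u + (t * inner u b) *: csub_val p)
    (cB + normc t * rnorm b * rnorm (csub_val p)).
  move=> u; apply: le_trans (rnormD _ _) _; rewrite mulrDl; apply: lerD; first exact: Bc.
  rewrite rnormZ normcM -!mulrA; apply: ler_wpM2l; first exact: normc_ge0.
  have := ler_wpM2r (rnorm_ge0 (csub_val p)) (inner_bounded b u).
  by rewrite -!mulrA [rnorm u * _]mulrC.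
have [B' B'E] := linear_bounded_bop B0l B0c.
(* As [phi] vanishes on [Xm], the perturbation keeps invariance and the spectral radius there. *)
have A'Xm x : Xm x -> A' x = As x.
  move=> xm; rewrite A'E /phi proj_along_eq0 // (linearP0 (@csub_val_linear _ _ Xp)).
  by rewrite linear0l mulr0 scale0r addr0.
have A'inv : invariant_under A' Xm by move=> x xm; rewrite A'Xm //; exact: As_Xm.
have [|_ /=] := stab (A', B').
  split=> /= [|k].
    exists A'inv; rewrite (_ : restrict_op A'inv = restrict_op As_Xm) //.
    by apply/funext => x; apply: val_inj; rewrite /= A'Xm //; exact: csub_valS.
  rewrite A'E B'E addrACA -data_As_Bs -scalerDl -mulrDr ab0 mulr0 scale0r addr0 //.
have F'l := closed_loop_linear A' B' K.
have [cF' _ F'c] := closed_loop_bounded A' B' K.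
apply: (not_power_stable_eigenvector F'l F'c _ lam1 y0); first by rewrite g1 (lt_le_trans gamma_m0).
by rewrite A'E B'E addrACA -scalerDl -mulrDr Fy.
Qed.

(** The graph of [K] on [Xp] lies in the range of [w |-> (Xi0 w, U0 w)], where [U0 w] is the
    combination of the inputs [u0]; a linear section of this map gives [W]. *)
Lemma right_inverse_of_informative g : gamma_m <= g < 1 ->
  informative Xm gamma_m x1 x0 u0 g ->
  exists W : 'L(Xp, 'rV[C]_N), (forall p, Xi0 (W p) = p) /\
    power_stable (Xi1 \o W) g.
Proof.
move=> gr [K [KXm stab]]; have graph p := data_span_graph p gr stab KXm.
have g0 : 0 < g by case/andP: gr => mg _; exact: lt_le_trans mg.
have Pl := proj_along_linear X_sum.
have Al : linear As := linearP As; have Bl : linear Bs := linearP Bs.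
pose L (w : 'rV[C]_N) : Xp * U := (Xi0 w, \sum_k w ord0 k *: u0 k).
have Ll : linear L.
  move=> a v w; congr (_, _) => /=; first exact: data_op_linear.
  rewrite scaler_sumr -big_split /=; apply: eq_bigr => k _.
  by rewrite !mxE scalerDl scalerA.
pose Lm : {linear 'rV[C]_N -> (Xp * U)%type} := HB.pack L (GRing.isLinear.Build _ _ _ _ L Ll).
have [s [sL sP]] := linear_section Lm.
have Lp p : exists w, Lm w = (p, K (csub_val p)).
  by have [w [w1 w2]] := graph p; exists w; rewrite /= /L w1 w2.
pose W0 p := s (p, K (csub_val p)).
have W0L p : L (W0 p) = (p, K (csub_val p)).
  by have [w wp] := Lp p; rewrite /W0 -wp; exact: sL.
have W0l : linear W0.
  move=> a p q; have [v vp] := Lp p; have [w wq] := Lp q.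
  rewrite /W0 -vp -wq -sP vp wq; congr (s (_, _)).
  by rewrite csub_val_linear linearP.
have [c _ W0c] := fin_linear_bounded X_sum Xp_fin W0l.
have [W WE] := linear_bounded_bop W0l W0c.
have Xi0W p : Xi0 (W p) = p by have := W0L p; rewrite -WE => -[].
have KW p : \sum_k (W p) ord0 k *: u0 k = K (csub_val p).
  by have := W0L p; rewrite -WE => -[].
exists W; split=> //.
have [/= _] : Sigma_stab Xm gamma_m K g (As, Bs) by apply: stab; split => //; exists As_Xm.
have Fl := closed_loop_linear As Bs K.
have [cF cF0 Fc] := closed_loop_bounded As Bs K.
move=> /(power_stableP Fl Fc g0)[M FM].
have Gl : linear (Xi1 \o W) by move=> a p q; rewrite /= linearP data_op_linear.
have [cG _ Gc] := fin_linear_bounded X_sum Xp_fin Gl.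
apply/(power_stableP Gl Gc g0).
have [cP cP0 Pc] := proj_along_bounded X_sum Xp_fin.
exists (cP * M) => k p.
(* The projection intertwines the closed loop with [Xi1 W], so power bounds pass to [Xi1 W] with the
   factor [cP]. *)
have FP x : Pi (As x + Bs (K x)) = Xi1 (W (Pi x)).
  rewrite -(data_op_step _ X_sum Al Bl As_Xm data_As_Bs) Xi0W KW.
  have xm := proj_alongP X_sum x.
  have -> : K x = K (csub_val (Pi x)).
    by apply/eqP; rewrite -subr_eq0 -linearB; apply/eqP; exact: KXm.
  rewrite !(linearPD _ _ Pl); congr (_ + _); apply/eqP; rewrite -subr_eq0.
  rewrite -(linearPB _ _ Pl) -(linearPB _ _ Al).
  by apply/eqP/proj_along_eq0 => //; exact: (As_Xm _).
have -> : iter k (Xi1 \o W) p = Pi (iter k (fun x => As x + Bs (K x)) (csub_val p)).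
  elim: k => [|k IHk]; first by rewrite /= proj_along_id.
  by rewrite !iterS FP -IHk.
apply: le_trans (Pc _) _; rewrite -!mulrA; apply: ler_wpM2l => //.
by rewrite mulrA; exact: FM.
Qed.

End Informativity.

Theorem theorem7p3 (R : realType) (X U : hilbertType R)
  (X_nontrivial : exists x : X, x != 0)
  (U_nontrivial : exists u : U, u != 0)
  (As : 'L(X, X)) (Bs : 'L(U, X))
  (N : nat) (N_gt0 : (0 < N)%N)
  (x1 x0 : 'I_N -> X) (u0 : 'I_N -> U)
  (data_As_Bs : forall k, x1 k = As (x0 k) + Bs (u0 k))
  (gamma_m : R) (gamma_m01 : 0 < gamma_m < 1)
  (Xp Xm : closedSubspace X)
  (X_sum : direct_sum Xp Xm) (Xp_fin : finite_dimensional Xp)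
  (As_Xm : invariant_under As Xm)
  (As_Xm_radius : spectral_radius (restrict_op As_Xm) <= gamma_m)
  (gamma : R) (gamma_range : gamma_m < gamma < 1) :
  let Xi1 := data_op Xp Xm x1 in
  let Xi0 := data_op Xp Xm x0 in
  (exists g : R, gamma_m <= g < gamma /\ informative Xm gamma_m x1 x0 u0 g)
  <->
  (range Xi0 = setT /\
   exists Xi0_inv : 'L(Xp, 'rV[R[i]]_N),
     (forall p, Xi0 (Xi0_inv p) = p) /\
     (exists g : R, gamma_m <= g < gamma /\ power_stable (Xi1 \o Xi0_inv) g)).
Proof.
have [m0 _] := andP gamma_m01; have [_ g1] := andP gamma_range.
move=> Xi1 Xi0; split=> [[g [/andP[mg gg] inf]]|[_ [W [WP [g [/andP[mg gg] Wst]]]]]].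
  have mg1 : gamma_m <= g < 1 by rewrite mg (lt_trans gg).
  have [W [WP Wst]] := right_inverse_of_informative data_As_Bs m0 X_sum Xp_fin
    As_Xm_radius mg1 inf.
  split; first by apply/seteqP; split=> // p _; exists (W p).
  by exists W; split=> //; exists g; split=> //; rewrite mg gg.
(* Passing from the right inverse to feedback loses some decay; the open end of the interval
   [[gamma_m, gamma)] leaves room for it. *)
pose g' := (g + gamma) / 2.
have [gg' g'g] : g < g' /\ g' < gamma by rewrite /g'; split; lra.
exists g'; split; first by rewrite g'g (le_trans mg) // ltW.
have mgg' : gamma_m <= g < g' by rewrite mg gg'.
exact: (informative_of_right_inverse u0 m0 X_sum Xp_fin mgg' WP Wst).
Qed.
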